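(* Let $\lambda_2$ be a positive integer. The average case complexity of the Novelli--Pak--Stoyanovskii algorithm on the partition $(\lambda_2,\lambda_2)$ is $$C(\lambda_2,\lambda_2)=\frac{\lambda_2(\lambda_2-2)}{2}-2\left(-\frac{2^{2\lambda_2}}{\binom{2\lambda_2}{\lambda_2}}+\frac{H_{\lambda_2}}{2}+1\right).$$
   Context: $H_m=\sum_{\ell=1}^m\frac1\ell$ denotes the $m$-th harmonic number. A partition $\lambda$ of $n$ is identified with its Young diagram $\{(i,j):1\le i\le l(\lambda),\ 1\le j\le\lambda_i\}$ ($l(\lambda)$ is the number of parts), whose elements are called cells. A cell $(i,j)$ is a corner of $\lambda$ if neither $(i+1,j)$ nor $(i,j+1)$ belongs to $\lambda$. A tableau of shape $\lambda$ is a bijection $T:\lambda\to\{1,\dots,n\}$; the set of tableaux is $\mathrm{T}(\lambda)$. The (column-wise) Novelli--Pak--Stoyanovskii (NPS) algorithm applied to $T\in \mathrm{T}(\lambda)$: order cells by $(i,j)\preceq(i',j')$ if $j<j'$, or $j=j'$ and $i\le i'$. Let $(i_1,j_1)\succ\dots\succ(i_n,j_n)$ be the cells of $\lambda$ in decreasing order, put $k_r=T(i_r,j_r)$ (entries of the initial tableau) and $T_0=T$. For $r=1,\dots,n$ the tableau $T_r$ is obtained from $T_{r-1}$ as follows. Start with the current tableau equal to $T_{r-1}$ and repeat: let $(i,j)$ be the cell of the current tableau containing $k_r$. If $(i,j)$ is a corner of $\lambda$, stop. Otherwise let $m$ be the minimum of the entries of the current tableau in the cells of $\lambda\cap\{(i+1,j),(i,j+1)\}$.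 If $k_r<m$, stop. If $m<k_r$, exchange the entries $m$ and $k_r$ (one exchange) and repeat. When stopped, $T_r$ is the current tableau. $n(T)$ is the total number of exchanges performed during the construction of $T_1,\dots,T_n$, and $C(\lambda)=\frac1{n!}\sum_{T\in \mathrm{T}(\lambda)}n(T)$; $C(\lambda_1,\lambda_2)$ means $C(\lambda)$ for $\lambda=(\lambda_1,\lambda_2)$. *)

(* Defs.v *)
From mathcomp Require Import all_boot all_order all_fingroup all_algebra.

Set Implicit Arguments.
Unset Strict Implicit.
Unset Printing Implicit Defensive.

Import GRing.Theory.

(* A partition is the nonincreasing list [lam] of its positive parts.  Cells   *)
(* carry 0-based coordinates (row, column); since the first part is the largest *)
(* one, the diagram is contained in the box 'I_(size lam) * 'I_(head 0 lam).    *)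
Definition cell (lam : seq nat) : finType :=
  {c : 'I_(size lam) * 'I_(head 0 lam) | c.2 < nth 0 lam c.1}.

Definition cell_row lam (c : cell lam) : nat := (val c).1.
Definition cell_col lam (c : cell lam) : nat := (val c).2.

(* Those of the cells (i+1, j) and (i, j+1) that lie in the diagram.           *)
Definition nbrs lam (c : cell lam) : {set cell lam} :=
  [set d | ((cell_row d == (cell_row c).+1) && (cell_col d == cell_col c))
        || ((cell_row d == cell_row c) && (cell_col d == (cell_col c).+1))].

Definition corner lam (c : cell lam) : bool := nbrs c == set0.

(* Fillings have entries in {0, ..., n}; [tableaux] keeps the bijections onto  *)
(* {1, ..., n}, where n = sumn lam.                                            *)
Definition filling (lam : seq nat) : finType :=
  {ffun cell lam -> 'I_(sumn lam).+1}.

Definition tableaux (lam : seq nat) : {set filling lam} :=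
  [set T : filling lam |
    injectiveb T && (T @: setT == [set k : 'I_(sumn lam).+1 | 0 < k])].

Definition exchange lam (T : filling lam) (c d : cell lam) : filling lam :=
  [ffun e => T (tperm c d e)].

(* The filling after one exchange of the entry k, or None when k has to stop.  *)
Definition nps_move lam (k : 'I_(sumn lam).+1) (T : filling lam) :
    option (filling lam) :=
  if [pick c | T c == k] is Some c then
    if corner c then None else
    if [pick d in nbrs c | [forall e in nbrs c, T d <= T e]] is Some d then
      if T d < k then Some (exchange T c d) else None
    else None
  else None.

Fixpoint nps_loop lam (k : 'I_(sumn lam).+1) (fuel : nat) (T : filling lam) :
    filling lam * nat :=
  if fuel is fuel'.+1 then
    if nps_move k T is Some T' then
      let: (T'', x) := nps_loop k fuel' T' in (T'', x.+1)
    else (T, 0)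
  else (T, 0).

(* Every exchange increases row + column of the cell containing k, hence this  *)
(* fuel is never exhausted: see [nps_insert_stopped].                          *)
Definition nps_insert lam (k : 'I_(sumn lam).+1) (T : filling lam) :=
  nps_loop k (size lam + head 0 lam) T.

Definition cell_le lam (c d : cell lam) : bool :=
  (cell_col c < cell_col d) || ((cell_col c == cell_col d) && (cell_row c <= cell_row d)).

Definition cells_decreasing lam : seq (cell lam) :=
  sort (fun c d => cell_le d c) (enum (cell lam)).

(* The final filling T_n and n(T); the inserted entry k_r = T (i_r, j_r) is    *)
(* read in the initial tableau T.                                              *)
Definition nps lam (T : filling lam) : filling lam * nat :=
  foldl (fun (st : filling lam * nat) c =>
           let: (T', x) := nps_insert (T c) st.1 in (T', st.2 + x))
        (T, 0) (cells_decreasing lam).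

Definition nb_exchanges lam (T : filling lam) : nat := (nps T).2.

Definition nps_complexity (lam : seq nat) : rat :=
  ((\sum_(T in tableaux lam) (nb_exchanges T)%:R) / ((sumn lam)`!)%:R)%R.

Definition harmonic (m : nat) : rat := (\sum_(1 <= l < m.+1) l%:R^-1)%R.

Lemma nps_loop_stopped lam (k : 'I_(sumn lam).+1) fuel (T : filling lam) c :
  injective T -> T c = k -> size lam + head 0 lam <= fuel + (cell_row c + cell_col c) ->
  nps_move k (nps_loop k fuel T).1 = None.
Proof.
elim: fuel T c => [|fuel IH] T c injT Tc le_fuel /=.
  have ltr : cell_row c < size lam by apply: ltn_ord.
  have ltc : cell_col c < head 0 lam by apply: ltn_ord.
  have := leq_trans (leq_add ltr (ltnW ltc)) le_fuel.
  by rewrite add0n ltnn.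
case E: (nps_move k T) => [T'|] //.
have [d nd ->] : exists2 d, d \in nbrs c & T' = exchange T c d.
  move: E; rewrite /nps_move; case: pickP => [c' /eqP Tc'|//].
  have {c' Tc'} -> : c' = c by apply: injT; rewrite Tc' Tc.
  case: (corner c) => //; case: pickP => [d /andP[nd _]|//].
  by case: ifP => // _ [<-]; exists d.
case L: (nps_loop k fuel (exchange T c d)) => [T'' x] /=.
have -> : T'' = (nps_loop k fuel (exchange T c d)).1 by rewrite L.
apply: (IH _ d).
- by move=> e f; rewrite !ffunE => /injT/perm_inj.
- by rewrite ffunE tpermR.
apply: leq_trans le_fuel _; move: nd; rewrite inE addSnnS leq_add2l.
by case/orP=> /andP[/eqP-> /eqP->]; rewrite ?addSn ?addnS.
Qed.

Lemma nps_insert_stopped lam (k : 'I_(sumn lam).+1) (T : filling lam) :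
  injective T -> nps_move k (nps_insert k T).1 = None.
Proof.
move=> injT; case: (pickP (fun c => T c == k)) => [c /eqP Tc|no_k].
  by apply: (nps_loop_stopped injT Tc); apply: leq_addr.
have stop : nps_move k T = None by rewrite /nps_move; case: pickP => // c; rewrite no_k.
by rewrite /nps_insert; case: (_ + _) => [|m] /=; rewrite stop.
Qed.

(* Main.v *)
Require Import Defs.
From mathcomp Require Import all_boot all_order all_fingroup all_algebra.
From mathcomp Require Import zify ring lra.

Set Implicit Arguments.
Unset Strict Implicit.
Unset Printing Implicit Defensive.

Import GRing.Theory Num.Theory.

(** Run column by column from the right, the algorithm keeps a standard tableau with two
    equal rows, i.e. a Dyck word [u]: list the entries increasingly and write [true]
    (first row) or [false] (second row).  Only relative ranks matter.  Inserting the
    bottom entry of the next column inserts a letter [false], which gives a word [v] such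
    that [true :: v] is a Dyck word; [v] has as many preimages as the semilength [w] of the
    first arch of [true :: v], and these cost 0, ..., w - 1 exchanges.  Inserting the top
    entry is a bijection (v, rank) -> (U, position q).  If [q] lies in the arch of [U]
    between abscissas 2a and 2b, then w = b when the letter at [q] is [true] and w = a + 1
    otherwise, so the number m(m+1) of preimages of [U] telescopes: the tableau stays
    uniformly distributed.  The exchanges add up, over the preimages of [U], to
    m^3 + m^2/2 + m/2 minus the sum of the squares of the arch semilengths.  By first-arch
    decomposition and the convolutions of Catalan numbers and central binomials, the sum
    of these squares over all Dyck words is (m^2 + 3m + 1) Cat(m) - 4^m. *)

(** * Dyck words *)

(** The left inverse gives injectivity, and the size bound then forces surjectivity; a one-sided
    inverse plus a cardinality count thus yields a bijection. *)
Lemma perm_map_in (T1 T2 : eqType) (f : T1 -> T2) (g : T2 -> T1) (X : seq T1) (Y : seq T2) :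
  uniq X -> uniq Y -> {in X, forall x, f x \in Y} ->
  {in X, cancel f g} -> size Y <= size X -> perm_eq (map f X) Y.
Proof.
move=> uX uY fX fK le_YX.
have uf : uniq (map f X).
  by rewrite map_inj_in_uniq // => x y xX yX /(congr1 g); rewrite !fK.
apply: uniq_perm => //.
have sub : {subset map f X <= Y} by move=> _ /mapP[x xX ->]; apply: fX.
by have [] := uniq_min_size uf sub; rewrite ?size_map.
Qed.

(* Paths with up steps [true] and down steps [false] that start at height [h], stay
   nonnegative and end at height 0. *)
Fixpoint bal (h : nat) (u : seq bool) : bool :=
  match u with
  | [::] => h == 0
  | true :: u' => bal h.+1 u'
  | false :: u' => if h is h'.+1 then bal h' u' else false
  end.

Lemma bal_cat h k u v : bal h u -> bal k v -> bal (h + k) (u ++ v).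
Proof.
elim: u h => [|[] u IH] [|h] //=; try exact: IH.
Qed.

Lemma bal_catK h k u v : bal h u -> bal (h + k) (u ++ v) = bal k v.
Proof.
by elim: u h => [|[] u IH] [|h] //= bu; apply: (IH _ bu).
Qed.

Lemma bal_count h u : bal h u -> h + count id u = count negb u.
Proof.
elim: u h => [|[] u IH] [|h] //= /IH; lia.
Qed.

Lemma bal_size h u : bal h u -> size u = h + (count id u).*2.
Proof.
move=> /bal_count bu; have := count_predC id u; rewrite /= -/negb.
rewrite (_ : count (predC id) u = count negb u) //; lia.
Qed.

(** * Inserting and deleting letters *)

Definition ins (T : Type) (s : nat) (b : T) (u : seq T) := take s u ++ b :: drop s u.
Definition del (T : Type) (s : nat) (u : seq T) := take s u ++ drop s.+1 u.

Lemma size_ins T s (b : T) u : size (ins s b u) = (size u).+1.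
Proof. by rewrite size_cat /= addnS -size_cat cat_take_drop. Qed.

Lemma size_del T s (u : seq T) : s < size u -> size (del s u) = (size u).-1.
Proof. by move=> lt; rewrite size_cat size_take lt size_drop; lia. Qed.

Lemma insK T s (b : T) u : s <= size u -> del s (ins s b u) = u.
Proof.
move=> le; rewrite /del /ins take_size_cat ?size_takel // -[s.+1]add1n -drop_drop.
by rewrite drop_size_cat ?size_takel //= drop0 cat_take_drop.
Qed.

Lemma delK T x0 s (u : seq T) : s < size u -> ins s (nth x0 u s) (del s u) = u.
Proof.
move=> lt; have le := ltnW lt.
rewrite /del /ins take_size_cat ?size_takel // drop_size_cat ?size_takel //.
by rewrite -drop_nth // cat_take_drop.
Qed.

Lemma nth_ins T x0 s (b : T) u : s <= size u -> nth x0 (ins s b u) s = b.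
Proof. by move=> le; rewrite nth_cat size_takel // ltnn subnn. Qed.

(** The part before the new down step is raised by one and the part after it keeps its height. *)
Lemma bal_ins_false h u s : bal h u -> bal h.+1 (ins s false u).
Proof.
elim: u h s => [|[] u IH] [|h] [|s] //= bu; rewrite -/(ins s false u); exact: IH.
Qed.

Lemma bal_del_true h u q : q < size u -> nth false u q -> bal h u -> bal h.+1 (del q u).
Proof.
elim: u h q => [|[] u IH] h [|q] //; rewrite /del /= -?/(del q u) ?drop0 //.
  exact: IH.
by case: h => // h; apply: IH.
Qed.

(** Cut at the first step from height [h.+1] down to [h]: before it, heights measured from [h.+1]
    are nonnegative. *)
Lemma bal_first k h v : bal (k + h.+1) v ->
  exists v1 v2, [/\ v = v1 ++ false :: v2, bal k v1 & bal h v2].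
Proof.
elim: v k => [|[] v IH] k /=; first by rewrite addnS.
  by rewrite -addSn => /IH[v1 [v2 [-> b1 b2]]]; exists (true :: v1), v2.
case: k => [|k] /=; first by move=> b2; exists [::], v.
by move=> /IH[v1 [v2 [-> b1 b2]]]; exists (false :: v1), v2.
Qed.

(* Index of the first step that leads below height 0. *)
Fixpoint fpos (h : nat) (v : seq bool) : nat :=
  match v with
  | [::] => 0
  | true :: v' => (fpos h.+1 v').+1
  | false :: v' => if h is h'.+1 then (fpos h' v').+1 else 0
  end.

Lemma fpos_cat h v1 v2 : bal h v1 -> fpos h (v1 ++ false :: v2) = size v1.
Proof. by elim: v1 h => [|[] v1 IH] [|h] //= bv; rewrite IH. Qed.

(** Here [n] is the length and not the semilength: the Dyck words of semilength [m] are
    [dyck 0 m.*2]. *)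
Fixpoint dyck (h n : nat) : seq (seq bool) :=
  if n is n'.+1 then
    map (cons true) (dyck h.+1 n') ++
    (if h is h'.+1 then map (cons false) (dyck h' n') else [::])
  else if h == 0 then [:: [::]] else [::].

Lemma mem_dyck h n u : (u \in dyck h n) = (size u == n) && bal h u.
Proof.
elim: n h u => [|n IH] h u /=.
  by case: h u => [|h] [|[] u].
rewrite mem_cat.
have mem_cons b s (X : seq (seq bool)) : (s \in map (cons b) X) = if s is c :: s' then (c == b)
  && (s' \in X) else false.
  case: s => [|c s]; first by apply/mapP => -[].
  apply/mapP/andP => [[x xX [-> ->]]|[/eqP-> sX]]; first by rewrite eqxx.
  by exists s.
case: h => [|h]; rewrite ?mem_cons ?orbF; case: u => [|[] u] //=; rewrite ?IH ?orbF ?eqSS //.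
by rewrite andbF.
Qed.

Lemma dyck_uniq h n : uniq (dyck h n).
Proof.
elim: n h => [|n IH] h /=; first by case: (h == 0).
have inj b : injective (cons b : seq bool -> _) by move=> x y [].
case: h => [|h]; first by rewrite cats0 map_inj_uniq.
rewrite cat_uniq !map_inj_uniq // !IH /= andbT.
by apply/hasPn => _ /mapP[x _ ->]; apply/mapP => -[].
Qed.

Lemma perm_map_bij (T1 T2 : eqType) (f : T1 -> T2) (g : T2 -> T1) (X : seq T1) (Y : seq T2) :
  uniq X -> uniq Y -> {in X, forall x, f x \in Y} -> {in Y, forall y, g y \in X} ->
  {in X, cancel f g} -> {in Y, cancel g f} -> perm_eq (map f X) Y.
Proof.
move=> uX uY fX gY fK gK; apply: (perm_map_in (g := g)) => //.
rewrite -(size_map g); apply: uniq_leq_size => [|_ /mapP[y yY ->]]; last exact: gY.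
by rewrite map_inj_in_uniq // => x y xY yY /(congr1 f); rewrite !gK.
Qed.

(** The prefix has net descent exactly [k], while a path that starts at [h] and stays nonnegative
    descends by at most [h]. *)
Lemma bal_prefix h k i u : bal h u -> bal k (take i u) -> k <= h.
Proof.
elim: u h k i => [|[] u IH] h k [|i] //=; do ?by move=> _ /eqP->.
  by move=> /IH b /b.
by case: h k => [|h] [|k] // /IH b /b.
Qed.

Section SumBool.
Local Open Scope ring_scope.

(** Counting the earlier occurrences of [b] numbers the positions of [b] as 0, 1, 2, and so on. *)
Lemma sum_count_take (V : nmodType) (b : bool) (u : seq bool) (G : nat -> V) :
  \sum_(0 <= q < size u | nth false u q == b) G (count (pred1 b) (take q u))
  = \sum_(0 <= i < count (pred1 b) u) G i.
Proof.
elim: u G => [|c u IH] G; first by rewrite !big_geq.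
rewrite big_mkcond /= big_nat_recl //= -big_mkcond /=.
under eq_bigr do rewrite ?take0 /=.
case: (c == b) => /=.
  by rewrite add1n big_nat_recl // (IH (fun i => G i.+1)).
by rewrite add0r (IH G).
Qed.
End SumBool.

(* Semilength of the first arch of [true :: v]. *)
Definition nret (v : seq bool) := (count negb (take (fpos 0 v) v)).+1.

Lemma nret_cat v1 v2 : bal 0 v1 -> nret (v1 ++ false :: v2) = (count negb v1).+1.
Proof. by move=> b1; rewrite /nret fpos_cat // take_size_cat. Qed.

(* The jeu de taquin slide of a top entry of rank [s]: the hole leaves the first row at the
   first passage below 0, unless the entry is smaller than the entry found there. *)
Definition slide (v : seq bool) (s : nat) : seq bool :=
  let p := fpos 0 v in
  if s <= p then ins s true v else ins s false (take p v ++ true :: drop p.+1 v).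

(** An entry that changes row passes the first-row entries before the first passage, goes down once,
    then passes smaller second-row entries. The part before the passage has as many letters [true]
    as [false], so the total is the number of letters [false] of rank below [s]. *)
Definition slide_cost (v : seq bool) (s : nat) : nat :=
  if s <= fpos 0 v then count id (take s v) else count negb (take s v).

Lemma drop_size_catS (T : Type) (v1 v2 : seq T) x : drop (size v1).+1 (v1 ++ x :: v2) = v2.
Proof. by rewrite -cat_rcons drop_size_cat // size_rcons. Qed.

Lemma ins_catl T s (b : T) u v : s <= size u -> ins s b (u ++ v) = ins s b u ++ v.
Proof.
move=> le; rewrite /ins takel_cat // drop_cat -catA cat_cons; case: ifP => // /negbT.
by rewrite -leqNgt => ge; rewrite (drop_oversize ge) (eqP (_ : s - size u == 0)) ?drop0.
Qed.

Lemma ins_catr T s (b : T) u v : ins (size u + s) b (u ++ v) = u ++ ins s b v.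
Proof. by rewrite /ins take_cat drop_cat !ltnNge leq_addr /= addKn catA. Qed.

Lemma del_catl T s (u v : seq T) : s < size u -> del s (u ++ v) = del s u ++ v.
Proof.
move=> lt; rewrite /del takel_cat ?(ltnW lt) // drop_cat -catA; case: ifP => // /negbT.
by rewrite -leqNgt => ge; rewrite (drop_oversize ge) (eqP (_ : s.+1 - size u == 0)) ?drop0.
Qed.

Lemma del_catr T s (u v : seq T) : del (size u + s) (u ++ v) = u ++ del s v.
Proof. by rewrite /del take_cat drop_cat !ltnNge leqW ?leq_addr //= -addnS !addKn catA. Qed.

Lemma slide_catl v1 v2 s : bal 0 v1 -> s <= size v1 ->
  slide (v1 ++ false :: v2) s = ins s true v1 ++ false :: v2.
Proof. by move=> b1 le; rewrite /slide fpos_cat // le ins_catl. Qed.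

Lemma slide_catr v1 v2 s : bal 0 v1 ->
  slide (v1 ++ false :: v2) ((size v1).+1 + s) = v1 ++ true :: ins s false v2.
Proof.
move=> b1; rewrite /slide fpos_cat // leqNgt leq_addr /=.
by rewrite take_size_cat // drop_size_catS -cat_rcons -(size_rcons v1 true) ins_catr cat_rcons.
Qed.

(** The inserted up step is compensated by the [false] after [v1], so [v2] still starts at height
    0. *)
Lemma bal_ins_true h s v1 v2 : s <= size v1 -> bal h v1 -> bal 0 v2 ->
  bal h (ins s true v1 ++ false :: v2).
Proof.
elim: v1 h s => [|b u IH] h [|s] // le b1 b2.
- by case: h b1.
- rewrite /ins take0 drop0 cat0s.
  suff: bal (h + 1) ((b :: u) ++ false :: v2) by rewrite addn1.
  exact: bal_cat.
- move: le b1; rewrite /ins /= -/(ins s true u) ltnS; case: b; first by move=> *; apply: IH.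
  by case: h => // h *; apply: IH.
Qed.

(** * Reindexing sums over insertions *)

Definition slots (X : seq (seq bool)) (n : nat) : seq (seq bool * nat) :=
  [seq (u, s) | u <- X, s <- iota 0 n].

Lemma mem_slots X n p : (p \in slots X n) = (p.1 \in X) && (p.2 < n).
Proof.
apply/allpairsP/andP => [[[u s] [uX]]|[uX lt]].
  by rewrite mem_iota /= => lt ->.
by exists p; rewrite mem_iota; case: p uX lt.
Qed.

Lemma slots_uniq X n : uniq X -> uniq (slots X n).
Proof.
move=> uX; apply: allpairs_uniq (iota_uniq _ _) _ => // -[u s] [v t] _ _ /= [-> ->] //.
Qed.

Section Sums.
Variable V : nmodType.
Local Open Scope ring_scope.

Lemma big_slots X n (P : pred (seq bool * nat)) (F : seq bool -> nat -> V) :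
  \sum_(p <- slots X n | P p) F p.1 p.2 = \sum_(u <- X) \sum_(0 <= s < n | P (u, s)) F u s.
Proof.
rewrite big_mkcond big_allpairs /=; apply: eq_bigr => u _.
by rewrite -big_mkcond /index_iota subn0.
Qed.

(** A preimage of [v] is a down step whose deletion leaves a Dyck word. These are the down steps up
    to and including the first passage below 0, so there are [nret v] of them, and the cost is their
    index. *)
Lemma sum_ins_false n (F : seq bool -> nat -> V) :
  \sum_(u <- dyck 0 n) \sum_(0 <= s < n.+1) F (ins s false u) (count negb (take s u))
  = \sum_(v <- dyck 1 n.+1) \sum_(0 <= i < nret v) F v i.
Proof.
pose X := slots (dyck 0 n) n.+1.
pose Q (p : seq bool * nat) := (nth false p.1 p.2 == false) && bal 0 (del p.2 p.1).
pose f (p : seq bool * nat) := (ins p.2 false p.1, p.2).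
pose g (p : seq bool * nat) := (del p.2 p.1, p.2).
pose Y := [seq p <- slots (dyck 1 n.+1) n.+1 | Q p].
pose G (p : seq bool * nat) := F p.1 (count negb (take p.2 p.1)).
have fXY : perm_eq (map f X) Y.
  apply: (perm_map_bij (g := g)).
  - by rewrite slots_uniq ?dyck_uniq.
  - by rewrite filter_uniq ?slots_uniq ?dyck_uniq.
  - move=> [u s]; rewrite mem_filter !mem_slots !mem_dyck /Q /= => /andP[/andP[/eqP su bu] lt].
    rewrite ltnS in lt.
    by rewrite nth_ins ?su // insK ?su // bu size_ins su eqxx bal_ins_false // ltnS eqxx /=.
  - move=> [v q]; rewrite mem_filter !mem_slots !mem_dyck /Q /= => /andP[/andP[_ bd]
    /andP[/andP[/eqP sv bv] lt]].
    by rewrite size_del sv // eqxx bd.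
  - move=> [u s]; rewrite mem_slots mem_dyck /= /f /g /= => /andP[/andP[/eqP su bu] lt].
    by rewrite insK // su.
  - move=> [v q]; rewrite mem_filter !mem_slots !mem_dyck /Q /f /g /= => /andP[/andP[/eqP vq bd]
    /andP[/andP[/eqP sv bv] lt]].
    by rewrite -vq delK // sv.
transitivity (\sum_(p <- X) G (f p)).
  rewrite (big_slots _ _ xpredT (fun u s => G (f (u, s)))); apply: eq_big_seq => u;
    rewrite mem_dyck => /andP[/eqP su _].
  rewrite !big_nat; apply: eq_bigr => s /andP[_ lt].
  by rewrite /G /f /= {2}/ins take_size_cat // size_takel // su.
rewrite -(big_map f xpredT G) (perm_big _ fXY) big_filter.
rewrite (big_slots _ _ Q (fun v q => F v (count negb (take q v)))).
apply: eq_big_seq => v; rewrite mem_dyck => /andP[/eqP sv bv].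
have [v1 [v2 [ev b1 b2]]] := bal_first (k := 0) bv.
have lt1 : (size v1 < n.+1)%N by rewrite -sv ev size_cat /= addnS ltnS leq_addr.
rewrite ev nret_cat // -ev.
(* The first-passage step is itself removable and accounts for the successor in [nret]. *)
have -> : (count negb v1).+1 = count (pred1 false) (rcons v1 false).
  by rewrite -cats1 count_cat /= addn1; congr (_.+1); apply: eq_count => -[].
rewrite -(sum_count_take _ _ (F v)).
(* A deletion to the right of the first passage leaves that passage in place, so no such position
   satisfies [Q]. *)
rewrite (big_cat_nat (n := (size v1).+1)) //= [X in _ + X](_ : _ = 0) ?addr0;
  last rewrite big_nat_cond big_pred0 //.
  have ev' : v = rcons v1 false ++ v2 by rewrite cat_rcons.
  rewrite size_rcons; apply: congr_big_nat => // q /andP[].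
    move=> _ lt; rewrite /Q /= ev' nth_cat size_rcons lt.
    case E: (_ == _) => //=.
    (* Removing one down step cancels the passage below 0, so [v2] is entered at height 0; the
       induction on [w] needs an arbitrary starting height. *)
    suff gen h w : bal h w -> (q <= size w)%N -> nth false (rcons w false) q = false ->
        bal h (del q (rcons w false ++ v2)) by apply: gen => //; apply/eqP.
    elim: w h q {lt E} => [|[] w IH] h [|q] //=.
    - by case: h => // _ _ _; rewrite /del /= drop0.
    - by move=> bw le E; rewrite /del /= -/(del q _); apply: IH.
    - case: h => // h bw le _; rewrite /del /= drop0 cat_rcons -addn1.
      exact: (bal_cat bw (k := 1)).
    - by case: h => // h bw le E; rewrite /del /= -/(del q _); apply: IH.
  move=> _ /andP[_ lt]; rewrite ev' takel_cat ?size_rcons 1?ltnW //.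
  by congr (F _ _); apply: eq_count => -[].
move=> q; apply/negP => /andP[/andP[lt _] /andP[_]] /=.
rewrite ev -cat_rcons -(subnKC lt) -(size_rcons v1 false) del_catr cat_rcons.
by have := bal_catK 0 (false :: del (q - (size (rcons v1 false))) v2) b1; rewrite addn0 => ->.
Qed.
End Sums.

(** Abscissa of the last visit to height 0 within the first [q] steps; abscissa 0 always
    qualifies. *)
Definition lastz (u : seq bool) (q : nat) : nat :=
  \max_(p < q.+1 | bal 0 (take p u)) p.

Lemma lastz_eq u q p : p <= q -> bal 0 (take p u) ->
  (forall r, p < r <= q -> ~~ bal 0 (take r u)) -> lastz u q = p.
Proof.
move=> le bp nb; apply/anti_leq/andP; split.
  apply/bigmax_leqP => [[r /= lt] br]; rewrite leqNgt; apply/negP => ltr.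
  by move: (nb r); rewrite ltr -ltnS lt br => /(_ isT).
have ltp : p < q.+1 by [].
exact: (leq_bigmax_cond (F := fun i : 'I_q.+1 => nat_of_ord i) (Ordinal ltp)).
Qed.

Lemma lastzP u q : [/\ lastz u q <= q, bal 0 (take (lastz u q) u) &
  forall r, lastz u q < r <= q -> ~~ bal 0 (take r u)].
Proof.
have [|[p /= lt] bp pmax] := @arg_maxnP _ (@ord0 q) (fun i => bal 0 (take i u)) (fun i => i).
  by rewrite take0.
suff -> : lastz u q = p.
  split => // r /andP[ltr le]; apply/negP => br.
  by have := pmax (inord r); rewrite /= inordK // leqNgt ltr => /(_ br).
apply: lastz_eq => // r /andP[ltr le]; apply/negP => br.
by have := pmax (inord r); rewrite /= inordK // leqNgt ltr => /(_ br).
Qed.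

(** A [true] at [q] is an entry that stayed in the first row and is just removed. A [false] is an
    entry that went down; the up step opening the arch around [q] is the one that [slide] had turned
    from [false] to [true]. *)
Definition slide_inv (u : seq bool) (q : nat) : seq bool :=
  let d := del q u in
  if nth false u q then d else take (lastz u q) d ++ false :: drop (lastz u q).+1 d.

Lemma nth_catr (T : Type) (x0 : T) s1 s2 i : nth x0 (s1 ++ s2) (size s1 + i) = nth x0 s2 i.
Proof. by rewrite nth_cat ltnNge leq_addr /= addKn. Qed.

Lemma take_catr (T : Type) (s1 s2 : seq T) i : take (size s1 + i) (s1 ++ s2) = s1 ++ take i s2.
Proof. by rewrite take_cat ltnNge leq_addr /= addKn. Qed.

Lemma lastz_arch a z q : bal 0 a -> (forall i, i <= q -> ~~ bal 1 (take i z)) ->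
  lastz (a ++ true :: z) ((size a).+1 + q) = size a.
Proof.
move=> ba nz; apply: lastz_eq; rewrite ?take_size_cat //; first lia.
move=> r /andP[gt le]; rewrite -(subnKC gt) -cat_rcons -(size_rcons a true) take_catr.
rewrite cat_rcons.
set w := take _ z; have := bal_catK 0 (true :: w) ba; rewrite addn0 => -> /=.
apply: nz; rewrite size_rcons; lia.
Qed.

Lemma slideK v s : bal 1 v -> s <= size v -> slide_inv (slide v s) s = v.
Proof.
move=> bv; have [v1 [v2 [-> b1 b2]]] := bal_first (k := 0) bv => le.
have [le1|gt1] := leqP s (size v1).
  rewrite slide_catl // /slide_inv nth_cat size_ins ltnS le1 nth_ins // del_catl ?insK //.
  by rewrite size_ins.
rewrite -(subnKC gt1) slide_catr // /slide_inv.
set k := s - _; have lek : k <= size v2 by move: le; rewrite size_cat /= /k; lia.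
rewrite -cat_rcons -(size_rcons v1 true) nth_catr nth_ins // del_catr insK //.
rewrite cat_rcons (cat_rcons true) size_rcons lastz_arch //.
  by rewrite take_size_cat // drop_size_catS.
(* Between the new up step and the inserted [false] the path follows [v2], which never goes below
   its start, so height 0 is not reached again. *)
move=> i lei; rewrite /ins takel_cat ?size_takel // -take_min (minn_idPl lei).
by apply/negP => /(bal_prefix b2).
Qed.

Lemma bal_slide v s : bal 1 v -> s <= size v -> bal 0 (slide v s).
Proof.
move=> bv; have [v1 [v2 [-> b1 b2]]] := bal_first (k := 0) bv => le.
have [le1|gt1] := leqP s (size v1); first by rewrite slide_catl // bal_ins_true.
rewrite -(subnKC gt1) slide_catr //; apply: (@bal_cat 0 0) => //=.
exact: bal_ins_false.
Qed.

Lemma size_slide v s : bal 1 v -> size (slide v s) = (size v).+1.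
Proof.
move=> bv; have [v1 [v2 [-> b1 b2]]] := bal_first (k := 0) bv.
have [le1|gt1] := leqP s (size v1); first by rewrite slide_catl // size_cat size_ins size_cat.
by rewrite -(subnKC gt1) slide_catr // size_cat [size (_ :: _)]/= size_ins size_cat /= addnS.
Qed.

Section Sums.
Variable V : nmodType.
Local Open Scope ring_scope.

(** With the rank kept, [slide] is a bijection: [slide_inv] is a left inverse and both sides have
    the same number of pairs. *)
Lemma sum_slide n (F : seq bool -> seq bool -> nat -> V) :
  \sum_(v <- dyck 1 n) \sum_(0 <= s < n.+1) F (slide v s) v s
  = \sum_(u <- dyck 0 n.+1) \sum_(0 <= q < n.+1) F u (slide_inv u q) q.
Proof.
pose X := slots (dyck 1 n) n.+1; pose Y := slots (dyck 0 n.+1) n.+1.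
pose f (p : seq bool * nat) := (slide p.1 p.2, p.2).
pose g (p : seq bool * nat) := (slide_inv p.1 p.2, p.2).
have fK : {in X, cancel f g}.
  move=> [v s]; rewrite mem_slots mem_dyck /f /g /= => /andP[/andP[/eqP sv bv] lt].
  by rewrite slideK ?sv.
have fXY : perm_eq (map f X) Y.
  apply: (perm_map_in (g := g)) => //.
  - by rewrite slots_uniq ?dyck_uniq.
  - by rewrite slots_uniq ?dyck_uniq.
  - move=> [v s]; rewrite !mem_slots !mem_dyck /= => /andP[/andP[/eqP sv bv] lt].
    by rewrite size_slide // sv eqxx bal_slide ?sv.
  (* A nonempty Dyck word begins with [true], so [dyck 0 n.+1] is as long as [dyck 1 n]. *)
  - by rewrite !size_allpairs /= cats0 size_map.
transitivity (\sum_(p <- X) F (f p).1 (g (f p)).1 (f p).2).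
  rewrite -(big_slots _ _ xpredT (fun v s => F (slide v s) v s)).
  by apply: eq_big_seq => p pX; rewrite (fK p pX).
rewrite -(big_map f xpredT (fun p => F p.1 (g p).1 p.2)) (perm_big _ fXY) /=.
by rewrite (big_slots _ _ xpredT (fun u q => F u (slide_inv u q) q)).
Qed.
End Sums.

(** * Arch decomposition *)

(** Induction on the number of arches, peeling off the first one. *)
Lemma dyck_ind (P : seq bool -> Prop) :
  P [::] ->
  (forall x y, bal 0 x -> bal 0 y -> P y -> P ((true :: rcons x false) ++ y)) ->
  forall u, bal 0 u -> P u.
Proof.
move=> P0 PS u; have [n] := ubnP (size u); elim: n u => // n IH [|[] u] //= lt bu.
have [x [y [eu bx yb]]] := bal_first (k := 0) bu; rewrite eu -cat_rcons -cat_cons.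
by apply: PS => //; apply: IH => //; move: lt; rewrite eu size_cat /=; lia.
Qed.

Section Arch.
Variables x y : seq bool.
Hypotheses (bx : bal 0 x) (yb : bal 0 y).
Let a := true :: rcons x false.
Let L := (count id x).+1.

Lemma bal_arch : bal 0 a.
Proof. by rewrite /a -cats1 /=; exact: (bal_cat bx (k := 1)). Qed.

Lemma count_arch b : count (pred1 b) a = L.
Proof.
have := bal_count bx; rewrite add0n /a /L -cats1 /= count_cat /= => e.
rewrite -(@eq_count _ (if b then id else negb)); last by case: b => -[].
by case: b; rewrite /= ?addn0 ?addn1 -?e ?add1n.
Qed.

Lemma count_archE : (count id a = L) * (count negb a = L).
Proof.
rewrite -{1}(count_arch true) -(count_arch false).
by split; apply: eq_count => -[].
Qed.

(** After an up step of the first arch is removed, the closing step of that arch becomes the first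
    passage below 0. The position [q] lies before it, so the cost counts letters [true]. *)
Lemma slide_inv_arch_true q : q < size a -> nth false a q ->
  (nret (slide_inv (a ++ y) q) = L) /\ (slide_cost (slide_inv (a ++ y) q) q = count (pred1 true)
    (take q a)).
Proof.
move=> lt aq; rewrite /slide_inv nth_cat lt aq.
have lt' : q < size (true :: x).
  rewrite /= ltnS leqNgt; apply/negP => gt; move: lt aq.
  rewrite /a /= size_rcons ltnS => le; rewrite (_ : q = (size x).+1) /= ?nth_rcons ?ltnn ?eqxx //.
  by apply/eqP; rewrite eqn_leq le gt.
have aE : a ++ y = (true :: x) ++ false :: y by rewrite /a cat_cons cat_rcons.
have xq : nth false (true :: x) q.
  by move: aq; rewrite /a -rcons_cons nth_rcons lt'.
rewrite aE del_catl //.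
have bd : bal 0 (del q (true :: x)).
  case: q lt' xq {lt aq} => [|q] /= lt' xq; first by rewrite /del /= drop0.
  by rewrite /del /= -/(del q x); apply: bal_del_true.
have cd : count negb (del q (true :: x)) = count id x.
  have := congr1 (count negb) (delK false lt');
    rewrite xq /ins count_cat /= add0n -count_cat cat_take_drop => ->.
  by rewrite add0n -(bal_count bx).
rewrite nret_cat // cd /slide_cost fpos_cat // size_del // -ltnS prednK // lt'; split => //.
rewrite takel_cat ?size_del //.
rewrite /del take_size_cat ?size_takel ?(ltnW lt') //.
rewrite /a -rcons_cons -cats1 takel_cat ?(ltnW lt') //.
by apply: eq_count => -[].
Qed.

(** The last zero before [q] is 0, so the opening step of the arch becomes [false] and the first
    passage is immediate. That new [false] is counted in the cost, whence the successor. *)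
Lemma slide_inv_arch_false q : q < size a -> ~~ nth false a q ->
  (nret (slide_inv (a ++ y) q) = 1) /\ (slide_cost (slide_inv (a ++ y) q) q = (count (pred1
    false) (take q a)).+1).
Proof.
move=> lt aq; rewrite /slide_inv nth_cat lt (negbTE aq).
case: q lt aq => [|q] // lt aq.
have -> : lastz (a ++ y) q.+1 = 0.
  apply: (@lastz_arch [::] (rcons x false ++ y) q) => // i le; move: lt;
    rewrite /a /= size_rcons ltnS => lt.
  rewrite cat_rcons takel_cat; last exact: leq_trans le _.
  by apply/negP => /(bal_prefix bx).
rewrite take0 cat0s /del /= drop0; split; first by rewrite /nret.
rewrite /slide_cost /= add1n take_cat add0n; congr (_.+1).
move: lt; rewrite /= ltnS => lt; rewrite size_takel ?size_cat; last by lia.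
rewrite ltnn subnn take0 cats0 takel_cat; last exact: ltnW.
by apply: eq_count => -[].
Qed.

Lemma lastz_arch_cat q : lastz (a ++ y) (size a + q) = size a + lastz y q.
Proof.
have [le bz nz] := lastzP y q; apply: lastz_eq; rewrite ?leq_add2l //.
  by rewrite take_catr; apply: (bal_cat bal_arch).
move=> r /andP[gt ler].
have ge : size a <= r by apply: leq_trans (ltnW gt); rewrite leq_addr.
rewrite -(subnKC ge) take_catr; have := bal_catK 0 (take (r - size a) y) bal_arch.
by rewrite addn0 => ->; apply: nz; lia.
Qed.

Lemma slide_inv_cat q : q < size y -> slide_inv (a ++ y) (size a + q) = a ++ slide_inv y q.
Proof.
move=> lt; rewrite /slide_inv nth_catr del_catr lastz_arch_cat; case: ifP => // _.
by rewrite take_catr -addnS drop_cat ltnNge leq_addr /= addKn catA.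
Qed.

Lemma fpos_arch v : fpos 0 (a ++ v) = size a + fpos 0 v.
Proof.
suff gen h w : bal h w -> fpos h (w ++ v) = size w + fpos 0 v by apply: gen bal_arch.
elim: w h => [|[] w IH] [|h] //= bw; by rewrite (IH _ bw) addSn.
Qed.

Lemma nret_arch v : nret (a ++ v) = L + nret v.
Proof. by rewrite /nret fpos_arch take_catr count_cat count_archE addnS. Qed.

Lemma slide_cost_arch v q : slide_cost (a ++ v) (size a + q) = L + slide_cost v q.
Proof.
by rewrite /slide_cost fpos_arch leq_add2l take_catr !count_cat !count_archE; case: ifP.
Qed.

Section Sum.
Variable V : nmodType.
Local Open Scope ring_scope.

(** The three sums come from the up steps of the first arch, its down steps, and the positions in
    [y]; for the latter the arch in front adds its semilength [L] to both statistics. *)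
Lemma sum_arch (F : nat -> nat -> V) :
  \sum_(0 <= q < size (a ++ y)) F (nret (slide_inv (a ++ y) q)) (slide_cost (slide_inv (a ++ y)
    q) q)
  = \sum_(0 <= i < L) F L i + \sum_(0 <= i < L) F 1%N i.+1
    + \sum_(0 <= q < size y) F (L + nret (slide_inv y q))%N (L + slide_cost (slide_inv y q) q)%N.
Proof.
rewrite size_cat (big_cat_nat (n := size a)) ?leq_addr //; congr (_ + _).
  rewrite (bigID (fun q => nth false a q == true)) /=; congr (_ + _).
    transitivity (\sum_(0 <= i < count (pred1 true) a) F L i); last by rewrite count_arch.
    rewrite -(sum_count_take true a (F L)) big_nat_cond [RHS]big_nat_cond.
    by apply: eq_bigr => q /andP[lt /eqP aq]; have [|-> ->] := slide_inv_arch_true lt.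
  transitivity (\sum_(0 <= i < count (pred1 false) a) F 1%N i.+1); last by rewrite count_arch.
  rewrite -(sum_count_take false a (fun i => F 1%N i.+1)) big_nat_cond [RHS]big_nat_cond.
  apply: eq_big => [q|q /andP[lt aq]]; first by case: (nth _ _ _).
  by have [|-> ->] := slide_inv_arch_false lt; first by case: (nth _ _ _) aq.
rewrite -{1}[size a]add0n big_addn addKn.
rewrite big_nat [RHS]big_nat; apply: eq_bigr => q lt.
by rewrite addnC slide_inv_cat // nret_arch slide_cost_arch.
Qed.
End Sum.
End Arch.

(** * Counting *)

Section Counting.
Local Open Scope ring_scope.

Lemma sum_nat_rat n : \sum_(0 <= i < n) (i%:R : rat) = n%:R * (n%:R - 1) / 2.
Proof.
elim: n => [|n IH]; first by rewrite big_geq // mul0r.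
by rewrite big_nat_recr //= IH -natr1; field.
Qed.

Lemma sum_const_nat (n : nat) (c : rat) : \sum_(0 <= i < n) c = n%:R * c.
Proof. by rewrite sumr_const_nat subn0 mulr_natl. Qed.

(** Number of column insertions that lead to [u]: [q] determines the top insertion and [nret] counts
    the bottom ones. *)
Definition sum_nret (u : seq bool) : rat :=
  \sum_(0 <= q < size u) (nret (slide_inv u q))%:R.
Definition sum_slide_cost (u : seq bool) : rat :=
  \sum_(0 <= q < size u) (slide_cost (slide_inv u q) q)%:R.
(* Exchanges made in one column, summed over the insertions that lead to [u]. *)
Definition col_cost (u : seq bool) : rat :=
  \sum_(0 <= q < size u) \sum_(0 <= i < nret (slide_inv u q)) (i + slide_cost (slide_inv u q) q)%:R.

Lemma col_costE u : col_cost u = \sum_(0 <= q < size u)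
  let w := (nret (slide_inv u q))%:R in let t := (slide_cost (slide_inv u q) q)%:R in
  w * (w - 1) / 2 + w * t.
Proof.
apply: eq_bigr => q _ /=; under eq_bigr do rewrite natrD.
by rewrite big_split /= sum_nat_rat sum_const_nat.
Qed.

(** A first arch of semilength L before a word of semilength m adds L^2 + L + 2mL, the increment of
    m(m+1) when m grows by L. *)
Lemma sum_nretE u : bal 0 u -> sum_nret u = (count id u)%:R * ((count id u)%:R + 1).
Proof.
elim/dyck_ind => [|x y bx yb IH]; first by rewrite /sum_nret big_geq //= mul0r.
rewrite /sum_nret (sum_arch bx yb (fun w _ => w%:R)) !sum_const_nat.
under [X in _ + X]eq_bigr do rewrite natrD.
rewrite big_split /= sum_const_nat -/(sum_nret y) IH (bal_size yb) add0n.
rewrite -cats1 !count_cat /= addn0 -muln2 !natrD !natrM; ring.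
Qed.

(** The first arch adds L(L-1)/2 + L(L+1)/2 + 2mL, the increment of m^2 when m grows by L. *)
Lemma sum_slide_costE u : bal 0 u -> sum_slide_cost u = (count id u)%:R ^+ 2.
Proof.
elim/dyck_ind => [|x y bx yb IH]; first by rewrite /sum_slide_cost big_geq //= mulr0.
rewrite /sum_slide_cost (sum_arch bx yb (fun _ t => t%:R)).
under [X in _ + X]eq_bigr do rewrite natrD.
rewrite big_split /= sum_const_nat -/(sum_slide_cost y) IH (bal_size yb) add0n.
under [X in _ + X + _]eq_bigr do rewrite -natr1.
rewrite big_split /= sum_nat_rat sum_const_nat.
rewrite -cats1 !count_cat /= addn0 -muln2 !natrD !natrM; by field.
Qed.

Definition arch_sq (u : seq bool) : rat :=
  let m := (count id u)%:R in m ^+ 3 + m ^+ 2 / 2 + m / 2 - col_cost u.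

Lemma arch_sq_nil : arch_sq [::] = 0.
Proof. by rewrite /arch_sq /col_cost big_geq //= !expr0n /= !mul0r; ring. Qed.

(* [arch_sq] is the sum of the squares of the semilengths of the arches. *)
Lemma arch_sq_cat x y : bal 0 x -> bal 0 y ->
  arch_sq ((true :: rcons x false) ++ y) = (count id x).+1%:R ^+ 2 + arch_sq y.
Proof.
move=> bx yb; rewrite /arch_sq !col_costE /=.
rewrite (sum_arch bx yb (fun w t => w%:R * (w%:R - 1) / 2 + w%:R * t%:R)).
set l : rat := (count id x).+1%:R.
have -> : \sum_(0 <= i < (count id x).+1) (l * (l - 1) / 2 + l * i%:R) =
    l * (l * (l - 1) / 2) + l * (l * (l - 1) / 2).
  by rewrite big_split /= sum_const_nat -mulr_sumr sum_nat_rat.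
have -> : \sum_(0 <= i < (count id x).+1) (1 * (1 - 1) / 2 + 1 * i.+1%:R : rat) =
    l * (l - 1) / 2 + l.
  under eq_bigr do rewrite subrr mulr0 mul0r add0r mul1r -natr1.
  by rewrite big_split /= sum_const_nat sum_nat_rat mulr1.
set m : rat := (count id y)%:R.
pose W q : rat := (nret (slide_inv y q))%:R.
pose T q : rat := (slide_cost (slide_inv y q) q)%:R.
(* Shifting both statistics by [l] leaves the cost of [y] plus terms linear in [W] and [T], whose
   sums are [sum_nret y] and [sum_slide_cost y]. *)
have -> : \sum_(0 <= q < size y) (((count id x).+1 + nret (slide_inv y q))%:R *
      (((count id x).+1 + nret (slide_inv y q))%:R - 1) / 2 +
      ((count id x).+1 + nret (slide_inv y q))%:R * ((count id x).+1 + slide_cost (slide_inv y q)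
        q)%:R) =
    \sum_(0 <= q < size y) (W q * (W q - 1) / 2 + W q * T q) +
    2 * l * sum_nret y + l * sum_slide_cost y + (size y)%:R * (l * (l - 1) / 2 + l ^+ 2).
  rewrite -(sum_const_nat (size y)) /sum_nret /sum_slide_cost !mulr_sumr -!big_split /=;
    apply: eq_bigr => q _.
  rewrite !natrD -/l -/(W q) -/(T q); by field.
rewrite sum_nretE // sum_slide_costE // -/m (bal_size yb) add0n -muln2 natrM -/m.
have -> : (1 + count id (rcons x false ++ y))%:R = l + m :> rat.
  by rewrite -cats1 !count_cat /= -natrD; congr _%:R; lia.
by field.
Qed.

Section Decomp.
Variable V : nmodType.

(** Summation form of the cut at the first passage: [i] is the length before it, and [n.-1]
    discounts the passage step. *)
Lemma sum_dyck_first k h n (F : seq bool -> V) :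
  \sum_(v <- dyck (k + h.+1) n) F v
  = \sum_(0 <= i < n) \sum_(x <- dyck k i) \sum_(y <- dyck h (n.-1 - i)) F (x ++ false :: y).
Proof.
elim: n k F => [|n IH] k F; first by rewrite addnS /= big_nil big_geq.
have cat_cons_dyck i (G : seq bool -> V) : \sum_(x <- dyck k i.+1) G x =
    \sum_(x <- dyck k.+1 i) G (true :: x) +
    (if k is k'.+1 then \sum_(x <- dyck k' i) G (false :: x) else 0).
  by rewrite /= big_cat big_map; case: (k) => [|k'] /=; rewrite ?big_nil ?big_map.
have -> : \sum_(v <- dyck (k + h.+1) n.+1) F v =
    \sum_(v <- dyck (k.+1 + h.+1) n) F (true :: v) + \sum_(v <- dyck (k + h) n) F (false :: v).
  by rewrite addSn addnS /= big_cat !big_map.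
rewrite (IH k.+1) big_nat_recl //.
under [X in _ = _ + X]eq_bigr => i _ do rewrite cat_cons_dyck.
rewrite big_split /= addrCA; congr (_ + _).
  rewrite !big_nat; apply: eq_bigr => i /andP[_ lt]; apply: eq_bigr => x _.
  by rewrite (_ : n.-1 - i = n - i.+1)%N //; lia.
case: k {cat_cons_dyck} => [|k].
  by rewrite add0n big_seq1 subn0 [X in _ + X]big1 ?addr0.
rewrite /= big_nil add0r addSnnS IH !big_nat; apply: eq_bigr => i /andP[_ lt].
by rewrite (_ : n.-1 - i = n - i.+1)%N //; lia.
Qed.

Lemma sum_even n (G : nat -> V) : (forall i, odd i -> G i = 0) ->
  \sum_(0 <= i < n.*2.+1) G i = \sum_(i < n.+1) G i.*2.
Proof.
move=> G0; elim: n => [|n IH]; first by rewrite big_nat1 big_ord1.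
by rewrite doubleS big_nat_recr //= big_nat_recr //= IH [RHS]big_ord_recr (G0 n.*2.+1) ?addr0 //=
  odd_double.
Qed.

Lemma dyck_odd n : odd n -> dyck 0 n = [::].
Proof.
move=> on; case E: (dyck 0 n) => [//|u s]; have: u \in dyck 0 n by rewrite E mem_head.
by rewrite mem_dyck => /andP[/eqP sz /bal_size]; rewrite sz add0n => e; rewrite e odd_double in on.
Qed.

Lemma sum_dyckS n (F : seq bool -> V) :
  \sum_(u <- dyck 0 n.+1.*2) F u
  = \sum_(i < n.+1) \sum_(x <- dyck 0 i.*2) \sum_(y <- dyck 0 (n - i).*2)
      F ((true :: rcons x false) ++ y).
Proof.
rewrite doubleS [dyck _ _]/= cats0 big_map.
rewrite [LHS](sum_dyck_first 0 0 n.*2.+1 (fun v => F (true :: v))) sum_even.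
  apply: eq_bigr => i _; apply: eq_bigr => x _; rewrite /= doubleB.
  by apply: eq_bigr => y _; rewrite cat_rcons.
by move=> i oi; rewrite dyck_odd ?big_nil.
Qed.
End Decomp.

(** Insertion of a whole column into [u]: [s] is the relative rank of the bottom entry, [s'] that of
    the top entry, which sees one entry more. *)
Definition step_sum (u : seq bool) (F : seq bool -> nat -> rat) : rat :=
  \sum_(0 <= s < (size u).+1) \sum_(0 <= s' < (size u).+2)
    F (slide (ins s false u) s') (count negb (take s u) + slide_cost (ins s false u) s')%N.

(** The two reindexings are chained: [sum_ins_false] for the bottom entry, then [sum_slide] for the
    top one. *)
Lemma sum_step n (F : seq bool -> nat -> rat) :
  \sum_(u <- dyck 0 n.*2) step_sum u F
  = \sum_(u <- dyck 0 n.+1.*2) \sum_(0 <= q < size u) \sum_(0 <= i < nret (slide_inv u q))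
      F u (i + slide_cost (slide_inv u q) q)%N.
Proof.
pose G v i := \sum_(0 <= s' < n.*2.+2) F (slide v s') (i + slide_cost v s')%N.
transitivity (\sum_(u <- dyck 0 n.*2) \sum_(0 <= s < n.*2.+1) G (ins s false u) (count negb (take
  s u))).
  by apply: eq_big_seq => u; rewrite mem_dyck => /andP[/eqP su _]; rewrite /step_sum su.
rewrite (sum_ins_false _ G) /G.
under eq_bigr do rewrite exchange_big /=.
rewrite (sum_slide _ (fun u v s => \sum_(0 <= i < nret v) F u (i + slide_cost v s)%N)) -doubleS.
by apply: eq_big_seq => u; rewrite mem_dyck => /andP[/eqP -> _].
Qed.

Lemma mem_dyck_count n u : u \in dyck 0 n.*2 -> bal 0 u /\ count id u = n.
Proof.
rewrite mem_dyck => /andP[/eqP su bu]; split => //.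
by have := bal_size bu; rewrite su add0n => /double_inj.
Qed.

(** This is the preservation of uniformity: the multiplicity [sum_nret u] depends only on the
    semilength of [u]. *)
Lemma sum_step_word n (F : seq bool -> rat) :
  \sum_(u <- dyck 0 n.*2) step_sum u (fun v _ => F v)
  = n.+1%:R * n.+2%:R * \sum_(u <- dyck 0 n.+1.*2) F u.
Proof.
rewrite sum_step mulr_sumr; apply: eq_big_seq => u /mem_dyck_count[bu cu].
under eq_bigr do rewrite sum_const_nat.
by rewrite -mulr_suml -/(sum_nret u) sum_nretE // cu natr1.
Qed.

Lemma sum_step_cost n :
  \sum_(u <- dyck 0 n.*2) step_sum u (fun _ x => x%:R)
  = \sum_(u <- dyck 0 n.+1.*2) col_cost u.
Proof. by rewrite sum_step. Qed.

(** * Catalan numbers, central binomial coefficients and their convolutions *)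

Definition catalan n : rat := (size (dyck 0 n.*2))%:R.

Lemma sum_dyck1 n : \sum_(u <- dyck 0 n.*2) (1 : rat) = catalan n.
Proof. by rewrite big_const_seq count_predT iter_addr addr0. Qed.

Lemma catalan0 : catalan 0 = 1. Proof. by []. Qed.

(** Double count of column insertions: there are (2n+1)(2n+2) per word of semilength n, and
    (n+1)(n+2) leading to each word of semilength n+1. *)
Lemma catalanS n : n.+2%:R * catalan n.+1 = (4 * n%:R + 2) * catalan n.
Proof.
have := sum_step_word n (fun _ => 1); rewrite sum_dyck1 => e.
have : \sum_(u <- dyck 0 n.*2) step_sum u (fun _ _ => 1) = (n.*2.+1%:R * n.*2.+2%:R) * catalan n.
  rewrite -sum_dyck1 mulr_sumr; apply: eq_big_seq => u; rewrite mem_dyck => /andP[/eqP su _].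
  by rewrite /step_sum su !sum_const_nat !mulr1.
rewrite e -doubleS -!muln2 -!natr1 !natrM -!natr1 => h.
apply: (@mulfI _ (n%:R + 1)); first by rewrite natr1 pnatr_eq0.
rewrite mulrA h; by ring.
Qed.

Lemma catalan_conv n : catalan n.+1 = \sum_(i < n.+1) catalan i * catalan (n - i).
Proof.
rewrite -sum_dyck1 sum_dyckS; apply: eq_bigr => i _.
rewrite -(sum_dyck1 i) mulr_suml; apply: eq_bigr => x _.
by rewrite mul1r -sum_dyck1.
Qed.

Definition arch_sq_sum n := \sum_(u <- dyck 0 n.*2) arch_sq u.

Lemma arch_sq_sumS n : arch_sq_sum n.+1 =
  \sum_(i < n.+1) (i.+1%:R ^+ 2 * catalan i * catalan (n - i) + catalan i * arch_sq_sum (n - i)).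
Proof.
rewrite /arch_sq_sum sum_dyckS; apply: eq_bigr => i _.
rewrite -mulrA mulrC -(sum_dyck1 i) !mulr_suml -big_split /=.
apply: eq_big_seq => x /mem_dyck_count[bx cx].
rewrite !mul1r -sum_dyck1 mulr_suml -big_split /=.
by apply: eq_big_seq => y /mem_dyck_count[yb _]; rewrite arch_sq_cat // cx mul1r.
Qed.

Definition conv (f g : nat -> rat) n := \sum_(i < n.+1) f i * g (n - i)%N.

Lemma convC f g n : conv f g n = conv g f n.
Proof.
rewrite /conv (reindex_inj rev_ord_inj); apply: eq_bigr => i _ /=.
by rewrite subSS subKn -1?ltnS // mulrC.
Qed.

Lemma convS f g n : conv f g n.+1 = f 0%N * g n.+1 + conv (fun i => f i.+1) g n.
Proof. by rewrite /conv big_ord_recl subn0; congr (_ + _). Qed.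

(** The central binomial coefficient, as [central_binE] shows; in this form its recurrence follows
    from [catalanS]. *)
Definition central_bin n : rat := n.+1%:R * catalan n.

Lemma central_bin0 : central_bin 0 = 1. Proof. by []. Qed.

Lemma central_binS n : n.+1%:R * central_bin n.+1 = (4 * n%:R + 2) * central_bin n.
Proof. by rewrite /central_bin catalanS; ring. Qed.

(** Product rule for the operator z d/dz on generating functions. *)
Lemma conv_weight f g n : conv (fun i => i%:R * f i) g n + conv f (fun i => i%:R * g i) n = n%:R
  * conv f g n.
Proof.
rewrite /conv -big_split mulr_sumr; apply: eq_bigr => i _ /=.
by rewrite natrB -1?ltnS //; ring.
Qed.

(** By symmetry the two weighted convolutions in the product rule agree; with [central_binS] this
    gives (n+1) c(n+1) = 4 (n+1) c(n) for the convolution c. *)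
Lemma conv_central_bin n : conv central_bin central_bin n = 4 ^+ n.
Proof.
elim: n => [|n IH]; first by rewrite /conv big_ord1 central_bin0.
have := conv_weight central_bin central_bin n.+1; rewrite [X in _ + X]convC convS !mul0r add0r.
have -> : conv (fun i => i.+1%:R * central_bin i.+1) central_bin n =
  4 * conv (fun i => i%:R * central_bin i) central_bin n + 2 * conv central_bin central_bin n.
  rewrite /conv !mulr_sumr -big_split; apply: eq_bigr => i _ /=; rewrite central_binS; ring.
have := conv_weight central_bin central_bin n; rewrite [X in _ + X]convC IH => e1 e2.
apply: (@mulfI _ n.+1%:R); first by rewrite pnatr_eq0.
by rewrite -e2 exprS -natr1; lra.
Qed.

(** Splitting off the term with exponent 0 gives c(n+1) = Cat(n+1) + 4 c(n), and [central_binS]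
    shows that the right-hand side satisfies the same recurrence. *)
Lemma conv_pow n : conv catalan (fun i => 4 ^+ i) n = (4 ^+ n.+1 - central_bin n.+1) / 2.
Proof.
have c1 : central_bin 1 = 2 by have := central_binS 0; rewrite central_bin0; lra.
elim: n => [|n IH]; first by rewrite /conv big_ord1 c1 catalan0; field.
rewrite convC convS.
have -> : conv (fun i => 4 ^+ i.+1) catalan n = 4 * conv catalan (fun i => 4 ^+ i) n.
  by rewrite convC /conv mulr_sumr; apply: eq_bigr => i _; rewrite exprS; ring.
rewrite IH expr0 mul1r.
have nz : n.+2%:R != 0 :> rat by rewrite pnatr_eq0.
have := central_binS n.+1; rewrite [central_bin n.+1]/central_bin => e.
apply: (mulfI nz); rewrite !mulrDr !mulrA.
rewrite ![4 ^+ n.+2]exprS -[n.+1%:R]natr1 in e *.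
rewrite -[n.+2%:R]natr1 -[n.+1%:R]natr1 in e *; lra.
Qed.

Lemma arch_sq_sumE n : arch_sq_sum n = (n%:R ^+ 2 + 3 * n%:R + 1) * catalan n - 4 ^+ n.
Proof.
elim/ltn_ind: n => -[_|n IH].
  by rewrite /arch_sq_sum /= big_seq1 arch_sq_nil catalan0; ring.
rewrite arch_sq_sumS.
pose sq i := i.+1%:R * central_bin i.
(* Symmetrization: the weights i+1 and n-i+1 add up to n+2. *)
have Q1 : conv central_bin catalan n = n.+2%:R * catalan n.+1 / 2.
  suff : conv central_bin catalan n + conv catalan central_bin n = n.+2%:R * catalan n.+1 by
    rewrite [conv catalan _ _]convC; lra.
  rewrite catalan_conv /conv -big_split mulr_sumr; apply: eq_bigr => i _ /=.
  by rewrite /central_bin -[n.+2%:R]natr1 -!natr1 natrB -1?ltnS //; ring.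
(* With a = i+1 and b = n-i+1, a^2 + b^2 = (n+2)^2 - 2ab, and the products ab give the convolution
   of central binomials, 4^n. *)
have Q2 : conv sq catalan n = (n.+2%:R ^+ 2 * catalan n.+1 - 2 * 4 ^+ n) / 2.
  suff : conv sq catalan n + conv catalan sq n = n.+2%:R ^+ 2 * catalan n.+1 - 2 * 4 ^+ n.
    by rewrite [conv catalan _ _]convC; lra.
  rewrite -conv_central_bin catalan_conv /conv -big_split !mulr_sumr -sumrB;
    apply: eq_bigr => i _ /=.
  by rewrite /sq /central_bin -[n.+2%:R]natr1 -!natr1 natrB -1?ltnS //; ring.
(* The induction hypothesis is split by m^2 + 3m + 1 = (m+1)^2 + (m+1) - 1. *)
have -> : \sum_(i < n.+1) (i.+1%:R ^+ 2 * catalan i * catalan (n - i) + catalan i * arch_sq_sum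
  (n - i)) =
   conv sq catalan n + conv catalan sq n + conv catalan central_bin n - catalan n.+1 - conv
     catalan (fun i => 4 ^+ i) n.
  rewrite /conv catalan_conv -!big_split -!sumrB /=; apply: eq_bigr => i _ /=.
  by rewrite IH ?ltnS ?leq_subr // /sq /central_bin -!natr1; ring.
rewrite [conv catalan sq n]convC [conv catalan central_bin n]convC Q1 Q2 conv_pow /central_bin.
by rewrite !exprS -!natr1; field.
Qed.

(** * Relative ranks and sums over permutations *)

Definition rank (x : nat) (s : seq nat) : nat := count (fun z => z < x)%N s.

Lemma perm_rank x s1 s2 : perm_eq s1 s2 -> rank x s1 = rank x s2.
Proof. by move=> /seq.permP e; apply: e. Qed.

Lemma rank_rem x s : x \in s -> rank x (rem x s) = rank x s.
Proof. by move=> /perm_to_rem /(perm_rank x) ->; rewrite /rank /= ltnn. Qed.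

Section Perm.
Variable V : nmodType.

Lemma sum_permutations (T : eqType) (s : seq T) (F : seq T -> V) : uniq s -> (0 < size s)%N ->
  \sum_(l <- permutations s) F l
  = \sum_(x <- s) \sum_(l <- permutations (rem x s)) F (x :: l).
Proof.
move=> us s0; rewrite -(big_allpairs_dep (h := fun x l => x :: l)).
apply: perm_big; apply: uniq_perm; first exact: permutations_uniq.
  apply: allpairs_uniq_dep => // [x _|[x l] [y k] _ _ [-> ->] //]; exact: permutations_uniq.
move=> l; rewrite mem_permutations; apply/idP/allpairsPdep.
  case: l => [|x l] pl; first by rewrite -(perm_size pl) in s0.
  have xs : x \in s by rewrite -(perm_mem pl) mem_head.
  exists x, l; split => //; rewrite mem_permutations -(perm_cons x).
  by rewrite (perm_trans pl) // perm_to_rem.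
move=> [x [k [xs]]]; rewrite mem_permutations => pk ->.
by rewrite perm_sym (perm_trans (perm_to_rem xs)) // perm_cons perm_sym.
Qed.

Lemma sum_rank (s : seq nat) (G : nat -> V) : uniq s ->
  \sum_(x <- s) G (rank x s) = \sum_(0 <= i < size s) G i.
Proof.
move=> us; rewrite -(big_map (fun x => rank x s) xpredT G); apply: perm_big.
have lt_rank x y : x \in s -> (x < y)%N -> (rank x s < rank y s)%N.
  move=> xs lt; rewrite /rank !(seq.permP (perm_to_rem xs)) /= ltnn lt add0n add1n ltnS.
  by apply: sub_count => z /= /leq_trans; apply; apply: ltnW.
have ur : uniq [seq rank x s | x <- s].
  rewrite map_inj_in_uniq // => x y xs ys e.
  by case: (ltngtP x y) => // lt; [have := lt_rank x y xs lt|have := lt_rank y x ys lt];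
    rewrite e ltnn.
rewrite /index_iota subn0; apply: uniq_perm; rewrite ?iota_uniq //.
have sub : {subset [seq rank x s | x <- s] <= iota 0 (size s)}.
  move=> _ /mapP[x xs ->];
    rewrite mem_iota /= add0n /rank (seq.permP (perm_to_rem xs)) /= ltnn add0n.
  by rewrite (perm_size (perm_to_rem xs)) ltnS count_size.
by have [] := uniq_min_size ur sub; rewrite ?size_map ?size_iota.
Qed.
End Perm.

(* [l] lists the entries column by column from the left, each top entry first. *)
Fixpoint word (l : seq nat) : seq bool :=
  if l is x :: y :: l' then slide (ins (rank y l') false (word l')) (rank x (y :: l')) else [::].

Fixpoint cost (l : seq nat) : nat :=
  if l is x :: y :: l' then
    (cost l' + (count negb (take (rank y l') (word l'))
                + slide_cost (ins (rank y l') false (word l')) (rank x (y :: l'))))%N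
  else 0%N.

Lemma even_size_ind (T : Type) (P : nat -> seq T -> Prop) :
  P 0%N [::] -> (forall n x y l, size l = n.*2 -> P n l -> P n.+1 (x :: y :: l)) ->
  forall n l, size l = n.*2 -> P n l.
Proof.
by move=> P0 PS; elim=> [|n IH] [|x [|y l]] //= [sl]; apply: PS => //; apply: IH.
Qed.

Lemma word_dyck n l : size l = n.*2 -> word l \in dyck 0 n.*2.
Proof.
move: n l; apply: even_size_ind => // n x y l sl; rewrite !mem_dyck /= => /andP[/eqP sw bw].
have bi : bal 1 (ins (rank y l) false (word l)) by apply: bal_ins_false.
rewrite size_slide // size_ins sw doubleS eqxx bal_slide // size_ins sw -sl.
exact: (count_size _ (y :: l)).
Qed.

(** The relative ranks of the first two entries are independent of the order of the others. If the
    word of the others is uniform with multiplicity [c], adding a column therefore amounts to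
    [step_sum]. *)
Lemma sum_perm_step n (s : seq nat) (H : seq nat -> rat) (F : seq bool -> nat -> rat) :
  uniq s -> size s = n.+1.*2 ->
  (forall x y l, H (x :: y :: l) = F (slide (ins (rank y l) false (word l)) (rank x (y :: l)))
     (count negb (take (rank y l) (word l)) + slide_cost (ins (rank y l) false (word l)) (rank x
       (y :: l)))%N) ->
  forall c,
  (forall (s' : seq nat) (G : seq bool -> rat), uniq s' -> size s' = n.*2 ->
    \sum_(l <- permutations s') G (word l) = c * \sum_(u <- dyck 0 n.*2) G u) ->
  \sum_(l <- permutations s) H l = c * \sum_(u <- dyck 0 n.*2) step_sum u F.
Proof.
move=> us ss HE c IH; rewrite sum_permutations ?ss //.
pose G r r' (w : seq bool) := F (slide (ins r false w) r') (count negb (take r w) + slide_cost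
  (ins r false w) r')%N.
transitivity (\sum_(x <- s) \sum_(y <- rem x s) \sum_(l <- permutations (rem y (rem x s)))
    G (rank y (rem x s)) (rank x s) (word l)).
  apply: eq_big_seq => x xs; rewrite sum_permutations ?rem_uniq ?size_rem ?ss //.
  apply: eq_big_seq => y ys; apply: eq_big_seq => l; rewrite mem_permutations => pl.
  (* An entry is not smaller than itself, so its rank is the same with or without it in the list;
     the ranks then no longer depend on the order of [l]. *)
  rewrite HE /G -(rank_rem ys) -(perm_rank y pl) -(rank_rem xs).
  by rewrite (perm_rank x (perm_to_rem ys)) (_ : rank x (y :: l) = rank x (y :: rem y (rem x s)))
    //; apply: perm_rank; rewrite perm_cons.
transitivity (c * \sum_(x <- s) \sum_(0 <= i < n.*2.+1) \sum_(u <- dyck 0 n.*2) G i (rank x s) u).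
  rewrite mulr_sumr; apply: eq_big_seq => x xs.
  have sr : size (rem x s) = n.*2.+1 by rewrite size_rem // ss doubleS.
  rewrite -sr -(sum_rank (fun i => \sum_(u <- dyck 0 n.*2) G i (rank x s) u)) ?rem_uniq //
    mulr_sumr.
  by apply: eq_big_seq => y ys; rewrite IH ?rem_uniq // size_rem // sr.
rewrite (sum_rank (fun r' => \sum_(0 <= i < n.*2.+1) \sum_(u <- dyck 0 n.*2) G i r' u)) // ss
  doubleS.
congr (_ * _); rewrite exchange_big /=; under eq_bigr do rewrite exchange_big /=.
rewrite exchange_big /=; apply: eq_big_seq => u; rewrite mem_dyck => /andP[/eqP su _].
by rewrite /step_sum su.
Qed.

(** Every Dyck word arises equally often; the multiplicity is the product of k(k+1) for k from 1 to
    n. *)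
Lemma sum_word n (s : seq nat) (G : seq bool -> rat) : uniq s -> size s = n.*2 ->
  \sum_(l <- permutations s) G (word l) = (n`! * n.+1`!)%:R * \sum_(u <- dyck 0 n.*2) G u.
Proof.
elim: n s G => [|n IH] s G us ss.
  by move/size0nil: ss => ->; rewrite /= !big_seq1 mul1r.
rewrite (sum_perm_step us ss (F := fun u _ => G u) _ IH) // sum_step_word mulrA; congr (_ * _).
by rewrite !factS !natrM; ring.
Qed.

Lemma sum_cost n (s : seq nat) : uniq s -> size s = n.+1.*2 ->
  \sum_(l <- permutations s) (cost l)%:R =
  \sum_(x <- s) \sum_(y <- rem x s) \sum_(l <- permutations (rem y (rem x s))) (cost l)%:R
  + (n`! * n.+1`!)%:R * \sum_(u <- dyck 0 n.+1.*2) col_cost u :> rat.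
Proof.
move=> us ss.
pose H (l : seq nat) : rat := if l is x :: y :: l' then (count negb (take (rank y l') (word l'))
  + slide_cost (ins (rank y l') false (word l')) (rank x (y :: l')))%N%:R else 0.
rewrite -sum_step_cost -(sum_perm_step us ss (H := H) (F := fun _ x => x%:R)) //;
  last exact: sum_word.
rewrite !sum_permutations ?ss // -big_split /=; apply: eq_big_seq => x xs.
rewrite !sum_permutations ?rem_uniq ?size_rem ?ss // -big_split /=; apply: eq_bigr => y _.
by rewrite -big_split /=; apply: eq_bigr => l _; rewrite natrD.
Qed.

(** The total mass in [sum_word]: there are (2n)! orderings in all. *)
Lemma catalan_fact n : (n`! * n.+1`!)%:R * catalan n = (n.*2)`!%:R.
Proof.
have := @sum_word n (iota 0 n.*2) (fun _ => 1) (iota_uniq _ _) (size_iota _ _).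
rewrite sum_dyck1 => <-.
by rewrite big_const_seq count_predT iter_addr addr0 size_permutations ?iota_uniq ?size_iota.
Qed.

Lemma central_binE n : central_bin n = 'C(2 * n, n)%:R.
Proof.
have nz k : (k`!)%:R != 0 :> rat by rewrite pnatr_eq0 -lt0n fact_gt0.
have le : (n <= 2 * n)%N by lia.
have := bin_fact le; rewrite (_ : 2 * n - n = n)%N; last lia.
move=> /(congr1 (fun k => k%:R : rat));
  rewrite [(2 * n)%N in RHS]mul2n -catalan_fact factS !natrM => e.
apply: (mulIf (nz n)); apply: (mulIf (nz n)); rewrite -[RHS]mulrA e /central_bin; ring.
Qed.

Definition closed_form (n : nat) : rat :=
  n%:R * (n%:R - 2) / 2 - 2 * (- (2 ^+ (2 * n) / 'C(2 * n, n)%:R) + harmonic n / 2 + 1).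

(** After division by (2n+2)!, this is the mean cost of the column that extends n columns to n+1;
    hence the total telescopes. *)
Lemma col_cost_sum n : (n`! * n.+1`!)%:R * \sum_(u <- dyck 0 n.+1.*2) col_cost u
  = (n.+1.*2)`!%:R * (closed_form n.+1 - closed_form n).
Proof.
set m : rat := n.+1%:R.
have mz : m != 0 by rewrite pnatr_eq0.
have m1z : m + 1 != 0 by rewrite natr1 pnatr_eq0.
have -> : \sum_(u <- dyck 0 n.+1.*2) col_cost u = (m ^+ 3 + m ^+ 2 / 2 + m / 2) * catalan n.+1 -
  arch_sq_sum n.+1.
  rewrite -sum_dyck1 mulr_sumr -sumrB; apply: eq_big_seq => u /mem_dyck_count[_ cu].
  by rewrite /arch_sq cu /m mulr1; ring.
rewrite arch_sq_sumE -catalan_fact -/m.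
have f1 : (n.+1`! * n.+2`!)%:R = m * (m + 1) * (n`! * n.+1`!)%:R.
  by rewrite natr1 /m -!natrM; congr _%:R; rewrite !factS; ring.
have cz k : catalan k != 0.
  have : (k.*2)`!%:R != 0 :> rat by rewrite pnatr_eq0 -lt0n fact_gt0.
  by rewrite -catalan_fact mulf_eq0 negb_or => /andP[].
have hS : harmonic n.+1 = harmonic n + m^-1 by rewrite /harmonic big_nat_recr.
rewrite /closed_form -!central_binE /central_bin hS f1 !exprM -/m.
(* The Catalan recurrence is solved for [catalan n], so that a single Catalan number remains for
   [field]. *)
have -> : catalan n = (m + 1) * catalan n.+1 / (4 * m - 2).
  have nz : 4 * n%:R + 2 != 0 :> rat by rewrite -natrM -natrD pnatr_eq0 addn2.
  rewrite (_ : 4 * m - 2 = 4 * n%:R + 2); last by rewrite /m -natr1; ring.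
  by rewrite natr1 catalanS mulrC mulKf.
have nm : n%:R = m - 1 by rewrite /m -natr1; ring.
have m2z : 4 * m - 2 != 0.
  have -> : 4 * m - 2 = (4 * n + 2)%:R by rewrite natrD natrM nm; ring.
  by rewrite pnatr_eq0 addn2.
rewrite -[n.+2%:R]natr1 -/m nm (_ : 2 ^+ 2 = 4) // ![4 ^+ n.+1]exprS.
have := cz n.+1; set c := catalan _; set p := 4 ^+ n; set h := harmonic n;
  set f := (_ * _)%:R => cnz.
clearbody m c f h p; field; by rewrite mz m1z m2z cnz.
Qed.

Lemma sum_cost_closed n (s : seq nat) : uniq s -> size s = n.*2 ->
  \sum_(l <- permutations s) (cost l)%:R = (n.*2)`!%:R * closed_form n.
Proof.
elim: n s => [|n IH] s us ss.
  move/size0nil: ss => ->; rewrite /= big_seq1 /closed_form /harmonic big_geq //= bin0; field.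
rewrite (sum_cost us ss) col_cost_sum.
transitivity (\sum_(x <- s) \sum_(y <- rem x s) (n.*2)`!%:R * closed_form n +
  (n.+1.*2)`!%:R * (closed_form n.+1 - closed_form n)).
  congr (_ + _); apply: eq_big_seq => x xs; apply: eq_big_seq => y ys.
  by rewrite IH ?rem_uniq // !size_rem // ss.
have -> : \sum_(x <- s) \sum_(y <- rem x s) (n.*2)`!%:R * closed_form n = (n.+1.*2)`!%:R *
  closed_form n.
  transitivity (\sum_(x <- s) n.*2.+1%:R * ((n.*2)`!%:R * closed_form n)).
    apply: eq_big_seq => x xs; rewrite big_const_seq count_predT iter_addr addr0 size_rem // ss.
    by rewrite doubleS [RHS]mulr_natl.
  rewrite big_const_seq count_predT iter_addr addr0 ss -mulr_natl doubleS !factS !natrM; ring.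
ring.
Qed.

End Counting.

(** * The algorithm on two rows *)

Lemma cell_inj lam (c d : cell lam) : cell_row c = cell_row d -> cell_col c = cell_col d -> c = d.
Proof.
move=> er ec; apply: val_inj; move: er ec; rewrite /cell_row /cell_col.
by case: (val c) (val d) => [i j] [i' j'] /= /val_inj -> /val_inj ->.
Qed.

Lemma nps_move_corner lam k (T : filling lam) c :
  injective T -> T c = k -> corner c -> nps_move k T = None.
Proof.
move=> injT Tc cc; rewrite /nps_move; case: pickP => // c' /eqP Tc'.
by rewrite (_ : c' = c) ?cc //; apply: injT; rewrite Tc.
Qed.

Lemma nps_move_min lam k (T : filling lam) c d :
  injective T -> T c = k -> d \in nbrs c -> {in nbrs c, forall e, T d <= T e} ->
  nps_move k T = if T d < k then Some (exchange T c d) else None.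
Proof.
move=> injT Tc dc dmin; rewrite /nps_move; case: pickP => [c' /eqP Tc'|/(_ c)];
  last by rewrite Tc eqxx.
have {c' Tc'} -> : c' = c by apply: injT; rewrite Tc.
rewrite /corner; case: eqP => [n0|_]; first by rewrite n0 inE in dc.
case: pickP => [d' /andP[d'c /forall_inP d'min]|/(_ d)]; last first.
  by rewrite dc /= => /forall_inP[].
suff -> : d' = d by [].
by apply/injT/val_inj/anti_leq; rewrite d'min // dmin.
Qed.

Lemma exchange_inj lam (T : filling lam) c d : injective T -> injective (exchange T c d).
Proof. by move=> injT e f; rewrite !ffunE => /injT/perm_inj. Qed.

Section TwoRows.
Variable N : nat.
Let lam := [:: N; N].
Implicit Types (T : filling lam) (c d e : cell lam) (k : 'I_(sumn lam).+1).

Lemma cell_rowP c : cell_row c < 2.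
Proof. exact: ltn_ord. Qed.

Lemma cell_colP c : cell_col c < N.
Proof. exact: ltn_ord (val c).2. Qed.

Lemma ex_cell i j : i < 2 -> j < N -> exists2 c : cell lam, cell_row c = i & cell_col c = j.
Proof.
move=> li lj; have lc : ((Ordinal li : 'I_(size lam)), (Ordinal lj : 'I_(head 0 lam))).2 < nth 0
  lam i.
  by case: i li => [|[|i]].
by exists (Sub (_, _) lc : cell lam); rewrite /cell_row /cell_col SubK.
Qed.

Definition has_rows T (a b : seq nat) :=
  [/\ size a = N, size b = N &
      forall c, T c = nth 0 (if cell_row c == 0 then a else b) (cell_col c) :> nat].

Lemma mem_nbrs c d : (d \in nbrs c) =
  ((cell_row d == (cell_row c).+1) && (cell_col d == cell_col c))
        || ((cell_row d == cell_row c) && (cell_col d == (cell_col c).+1)).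
Proof. by rewrite inE. Qed.

Lemma nth_catC (s1 s2 : seq nat) x : nth 0 (s1 ++ x :: s2) (size s1) = x.
Proof. by rewrite nth_cat ltnn subnn. Qed.

Lemma nth_catCS (s1 s2 : seq nat) x y : nth 0 (s1 ++ x :: y :: s2) (size s1).+1 = y.
Proof. by rewrite nth_cat ltnNge leqnSn subSnn. Qed.

Lemma nth_cat_neq (s1 s2 : seq nat) x y j : j != size s1 ->
  nth 0 (s1 ++ x :: s2) j = nth 0 (s1 ++ y :: s2) j.
Proof.
move=> ne; rewrite !nth_cat; case: ltngtP ne => // gt _.
by rewrite -(subnSK gt).
Qed.

Lemma nth_swap (s1 s2 : seq nat) x y j : j != size s1 -> j != (size s1).+1 ->
  nth 0 (s1 ++ x :: y :: s2) j = nth 0 (s1 ++ y :: x :: s2) j.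
Proof.
move=> ne1 ne2; rewrite (nth_cat_neq _ _ y) // -(cat_rcons y s1 (y :: s2)) -(cat_rcons y s1 (x ::
  s2)).
by rewrite (nth_cat_neq _ _ x) // size_rcons.
Qed.

Lemma exchange_row0 T a0 x y a1 b c d : has_rows T (a0 ++ x :: y :: a1) b ->
  cell_row c = 0 -> cell_col c = size a0 -> cell_row d = 0 -> cell_col d = (size a0).+1 ->
  has_rows (exchange T c d) (a0 ++ y :: x :: a1) b.
Proof.
move=> [sa sb Tab] rc cc rd cd; split => //; first by rewrite -sa !size_cat.
move=> e; rewrite ffunE; case: tpermP => [->|->|/eqP ec /eqP ed]; rewrite Tab.
- by rewrite rc rd cc cd /= nth_catC nth_catCS.
- by rewrite rc rd cc cd /= nth_catC nth_catCS.
- case: eqP => // re; apply: nth_swap.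
  + by apply: contra ec => /eqP ce; apply/eqP/cell_inj; rewrite ?re ?ce.
  + by apply: contra ed => /eqP ce; apply/eqP/cell_inj; rewrite ?re ?ce.
Qed.

Lemma row1E e : cell_row e != 0 -> cell_row e = 1.
Proof. by have := cell_rowP e; case: (cell_row e) => [|[]]. Qed.

Lemma exchange_row1 T a b0 x y b1 c d : has_rows T a (b0 ++ x :: y :: b1) ->
  cell_row c = 1 -> cell_col c = size b0 -> cell_row d = 1 -> cell_col d = (size b0).+1 ->
  has_rows (exchange T c d) a (b0 ++ y :: x :: b1).
Proof.
move=> [sa sb Tab] rc cc rd cd; split => //; first by rewrite -sb !size_cat.
move=> e; rewrite ffunE; case: tpermP => [->|->|/eqP ec /eqP ed]; rewrite Tab.
- by rewrite rc rd cc cd /= nth_catC nth_catCS.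
- by rewrite rc rd cc cd /= nth_catC nth_catCS.
- case: ifPn => // /row1E re; apply: nth_swap.
  + by apply: contra ec => /eqP ce; apply/eqP/cell_inj; rewrite ?re ?ce.
  + by apply: contra ed => /eqP ce; apply/eqP/cell_inj; rewrite ?re ?ce.
Qed.

Lemma exchange_col T a0 x a1 b0 y b1 c d : has_rows T (a0 ++ x :: a1) (b0 ++ y :: b1) ->
  size a0 = size b0 ->
  cell_row c = 0 -> cell_col c = size a0 -> cell_row d = 1 -> cell_col d = size a0 ->
  has_rows (exchange T c d) (a0 ++ y :: a1) (b0 ++ x :: b1).
Proof.
move=> [sa sb Tab] sab rc cc rd cd; split; first by rewrite -sa !size_cat.
  by rewrite -sb !size_cat.
move=> e; rewrite ffunE; case: tpermP => [->|->|/eqP ec /eqP ed]; rewrite Tab.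
- by rewrite rc rd cc cd /= nth_catC sab nth_catC.
- by rewrite rc rd cc cd /= nth_catC sab nth_catC.
- case: ifPn => [/eqP re|/row1E re]; apply: nth_cat_neq.
  + by apply: contra ec => /eqP ce; apply/eqP/cell_inj; rewrite ?re ?ce.
  + by apply: contra ed => /eqP ce; apply/eqP/cell_inj; rewrite ?re ?ce ?cd ?sab.
Qed.

(** The row after [k], placed to the left of a sorted [r], has moved past all smaller entries. *)
Definition insl (k : nat) (r : seq nat) :=
  [seq y <- r | y < k] ++ k :: [seq y <- r | ~~ (y < k)].

Lemma insl_ge (k : nat) x r : ~~ (x < k) -> path ltn x r -> insl k (x :: r) = k :: x :: r.
Proof.
move=> ge /(order_path_min ltn_trans) /allP xr; rewrite /insl /= (negbTE ge) /=.
have lt y : y \in r -> (y < k) = false.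
  by move=> /xr xy; apply/negbTE; rewrite -leqNgt (leq_trans _ (ltnW xy)) // leqNgt.
rewrite (eq_in_filter (a2 := pred0)) // filter_pred0.
by rewrite (@eq_in_filter _ _ predT) ?filter_predT // => y /lt ->.
Qed.

Lemma count_ge (k : nat) x r : ~~ (x < k) -> path ltn x r -> count (fun y => y < k) (x :: r) = 0.
Proof.
move=> ge /(order_path_min ltn_trans) /allP xr; rewrite /= (negbTE ge) add0n.
apply/eqP; rewrite -leqn0 leqNgt -has_count; apply/hasPn => y /xr xy.
by rewrite -leqNgt (leq_trans _ (ltnW xy)) // leqNgt.
Qed.

Lemma insl_lt (k : nat) x r : x < k -> insl k (x :: r) = x :: insl k r.
Proof. by rewrite /insl /= => ->. Qed.

(** In the second row the only possible neighbour is on the right, so the loop is one insertion of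
    insertion sort. *)
Lemma loop_row1 k fuel T a b0 r : injective T -> has_rows T a (b0 ++ (k : nat) :: r) ->
  sorted ltn r -> size r <= fuel ->
  exists2 T', nps_loop k fuel T = (T', count (fun y => y < k) r) &
    injective T' /\ has_rows T' a (b0 ++ insl k r).
Proof.
elim: r fuel T b0 => [|x r IH] fuel T b0 injT rT sr le.
  exists T => //; case: fuel {le} => //= f; have [sa sb Tab] := rT.
  have lt0 : size b0 < N by rewrite -sb size_cat addnS addn0.
  have [c rc cc] := ex_cell (isT : 1 < 2) lt0.
  rewrite (@nps_move_corner _ _ _ c) //.
    by apply: ord_inj; rewrite Tab rc cc nth_catC.
  apply/eqP/setP => d; rewrite mem_nbrs rc cc !inE; apply/negP => /orP[]/andP[/eqP rd /eqP cd].
    by have := cell_rowP d; rewrite rd.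
  by have := cell_colP d; rewrite cd -sb size_cat addnS addn0 ltnn.
case: fuel le => // f le; have [sa sb Tab] := rT.
have lt1 : (size b0).+1 < N by rewrite -sb size_cat /=; lia.
have [c rc cc] := ex_cell (isT : 1 < 2) (ltnW lt1).
have [d rd cd] := ex_cell (isT : 1 < 2) lt1.
have Tc : T c = k by apply: ord_inj; rewrite Tab rc cc nth_catC.
have Td : T d = x :> nat by rewrite Tab rd cd nth_catCS.
have nb e : e \in nbrs c -> e = d.
  rewrite mem_nbrs rc cc => /orP[]/andP[/eqP re /eqP ce].
    by have := cell_rowP e; rewrite re.
  by apply: cell_inj; rewrite ?re ?ce ?rd ?cd.
rewrite /= (nps_move_min injT Tc (d := d)); first last.
- by move=> e /nb ->.
- by rewrite mem_nbrs rc cc rd cd !eqxx orbT.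
rewrite Td; case: ifPn => [lt|ge]; last first.
  have -> : count (fun y => y < k) r = 0.
    by have := count_ge ge sr; rewrite /= (negbTE ge) add0n.
  by exists T => //; rewrite insl_ge.
have rT' := exchange_row1 rT rc cc rd cd; rewrite -cat_rcons in rT'.
have [T' -> [injT' rT'']] := IH f _ _ (exchange_inj (c := c) (d := d) injT) rT' (path_sorted sr) le.
by exists T' => //; rewrite insl_lt // -cat_rcons.
Qed.

(** Since [k] occupies a cell, the entry to its right is compared with the entry below [k]. Along
    [t1] the right one is smaller and [k] moves right; at the end of [t1] the entry below is [y],
    smaller than all of [t2], and [k] goes down exactly when [y < k]. *)
Lemma loop_row0 k fuel T a0 t1 t2 b0 r1 y r2 : injective T ->
  has_rows T (a0 ++ (k : nat) :: t1 ++ t2) (b0 ++ r1 ++ y :: r2) -> size a0 = size b0 ->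
  size t1 = size r1 -> all2 ltn t1 r1 -> all (ltn y) t2 ->
  sorted ltn (t1 ++ t2) -> sorted ltn (r1 ++ y :: r2) -> size t1 + size r2 < fuel ->
  exists2 T', nps_loop k fuel T =
      (T', if y < k then (size t1).+1 + count (fun z => z < k) r2
           else count (fun z => z < k) (t1 ++ t2)) &
    injective T' /\
    (if y < k then has_rows T' (a0 ++ t1 ++ y :: t2) (b0 ++ r1 ++ insl k r2)
     else has_rows T' (a0 ++ insl k (t1 ++ t2)) (b0 ++ r1 ++ y :: r2)).
Proof.
elim: t1 r1 fuel T a0 b0 => [|x t1 IH] [|z r1] // fuel T a0 b0 injT rT sab.
  move=> _ _ yt2 st sr; case: fuel => // f le; have [sa sb Tab] := rT.
  have lt0 : size a0 < N by rewrite -sa size_cat /=; lia.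
  have [c rc cc] := ex_cell (isT : 0 < 2) lt0.
  have [d rd cd] := ex_cell (isT : 1 < 2) lt0.
  have Tc : T c = k by apply: ord_inj; rewrite Tab rc cc nth_catC.
  have Td : T d = y :> nat by rewrite Tab rd cd /= sab nth_catC.
  rewrite [nps_loop _ _ _]/= (nps_move_min injT Tc (d := d)); first last.
  - move=> e; rewrite mem_nbrs rc cc => /orP[]/andP[/eqP re /eqP ce].
      by rewrite (_ : e = d) //; apply: cell_inj; rewrite ?re ?ce ?rd ?cd.
    have := cell_colP e; rewrite ce -sa size_cat /=.
    rewrite Td Tab re ce /=; case: t2 yt2 {rT st sa Tab} => [|x t2] /=; first by rewrite addn1 ltnn.
    by move=> /andP[yx _] _; rewrite nth_catCS ltnW.
  - by rewrite mem_nbrs rc cc rd cd !eqxx.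
  rewrite Td; case: ifPn => [lt|ge].
    have rT' := exchange_col rT sab rc cc rd cd.
    have [T' -> rT''] := loop_row1 (exchange_inj (c := c) (d := d) injT) rT' (path_sorted sr) (le
      : size r2 <= f).
    by exists T'.
  exists T; last split => //.
    case: t2 yt2 st {rT sa Tab} => //= x t2 /andP[yx _] st.
    have ge' : ~~ (x < k) by lia.
    by have := count_ge ge' st; rewrite /= => ->.
  case: t2 yt2 st rT {sa Tab} => //= x t2 /andP[yx _] st rT.
  have ge' : ~~ (x < k) by lia.
  by rewrite insl_ge.
move=> [st1] /= /andP[xz tr] yt2 st sr; case: fuel => // f le; have [sa sb Tab] := rT.
have lt1 : (size a0).+1 < N by rewrite -sa size_cat /=; lia.
have [c rc cc] := ex_cell (isT : 0 < 2) (ltnW lt1).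
have [d rd cd] := ex_cell (isT : 0 < 2) lt1.
have Tc : T c = k by apply: ord_inj; rewrite Tab rc cc nth_catC.
have Td : T d = x :> nat by rewrite Tab rd cd /= nth_catCS.
rewrite [nps_loop _ _ _]/= (nps_move_min injT Tc (d := d)); first last.
- move=> e; rewrite mem_nbrs rc cc => /orP[]/andP[/eqP re /eqP ce].
    by rewrite Td Tab re ce /= sab nth_catC ltnW.
  by rewrite (_ : e = d) //; apply: cell_inj; rewrite ?re ?ce ?rd ?cd.
- by rewrite mem_nbrs rc cc rd cd !eqxx.
rewrite Td; have zy : z < y.
  by move: sr => /(order_path_min ltn_trans) /allP; apply; rewrite mem_cat mem_head orbT.
case: ifPn => [lt|ge].
  have rT' := exchange_row0 rT rc cc rd cd.
  rewrite -cat_rcons -[b0 ++ _]cat_rcons in rT'.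
  have [||T' -> [injT' rT'']] := IH r1 f _ (rcons a0 x) (rcons b0 z) (exchange_inj (c := c) (d :=
    d) injT) rT' _ st1 tr yt2 (path_sorted st) (path_sorted sr) _.
  - by rewrite !size_rcons sab.
  - by [].
  exists T'; first by case: ifP.
  split => //; move: rT''; rewrite !cat_rcons; case: ifP => // _.
  by rewrite insl_lt.
(* An early stop excludes the downward case, since k <= x < z < y. *)
have -> : (y < k) = false by lia.
exists T; first by have := count_ge ge st; rewrite /= (negbTE ge) => ->.
by split => //; rewrite insl_ge.
Qed.
End TwoRows.

(* The sorted columns are encoded by the increasing list of their entries, tagged [true] in
   the first row and [false] in the second. *)
Definition keys (S : seq (nat * bool)) := map fst S.
Definition tags (S : seq (nat * bool)) := map snd S.
Definition row_keys (b : bool) (S : seq (nat * bool)) := [seq p.1 | p <- S & p.2 == b].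

Lemma row_keys_cat b S1 S2 : row_keys b (S1 ++ S2) = row_keys b S1 ++ row_keys b S2.
Proof. by rewrite /row_keys filter_cat map_cat. Qed.

Lemma mem_row_keys b S x : x \in row_keys b S -> x \in keys S.
Proof. by move=> /mapP[p]; rewrite mem_filter => /andP[_ pS] ->; apply: map_f. Qed.

Lemma sorted_row_keys b S : sorted ltn (keys S) -> sorted ltn (row_keys b S).
Proof.
move=> sS; apply: (subseq_sorted ltn_trans) sS.
exact/map_subseq/filter_subseq.
Qed.

Lemma size_row_keys b S : size (row_keys b S) = count (pred1 b) (tags S).
Proof. by rewrite size_map size_filter count_map. Qed.

Definition inss (e : nat * bool) (S : seq (nat * bool)) :=
  [seq p <- S | p.1 < e.1] ++ e :: [seq p <- S | ~~ (p.1 < e.1)].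

Lemma filter_sorted x S : sorted ltn (keys S) ->
  [seq p <- S | p.1 < x] = take (rank x (keys S)) S /\
  [seq p <- S | ~~ (p.1 < x)] = drop (rank x (keys S)) S.
Proof.
elim: S => //= -[y b] S IH /= sS; have [IH1 IH2] := IH (path_sorted sS).
rewrite /rank /= -/(rank x (keys S)); case: ifPn => [lt|ge] /=; first by rewrite IH1 IH2.
have := order_path_min ltn_trans sS => /allP yS.
have r0 : rank x (keys S) = 0.
  apply/eqP; rewrite -leqn0 leqNgt -has_count; apply/hasPn => z /yS yz.
  by rewrite -leqNgt (leq_trans _ (ltnW yz)) // leqNgt.
by rewrite IH1 IH2 r0 take0 drop0.
Qed.

Lemma inssE x b S : sorted ltn (keys S) -> inss (x, b) S = ins (rank x (keys S)) (x, b) S.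
Proof. by move=> /(filter_sorted x)[e1 e2]; rewrite /inss e1 e2. Qed.

Lemma tags_inss x b S : sorted ltn (keys S) ->
  tags (inss (x, b) S) = ins (rank x (keys S)) b (tags S).
Proof. by move=> sS; rewrite inssE // /tags /ins map_cat /= map_take map_drop. Qed.

Lemma perm_inss e S : perm_eq (inss e S) (e :: S).
Proof.
rewrite /inss -cat_rcons perm_catC perm_sym -cat1s perm_sym.
by rewrite -cats1 catA perm_catC /= perm_cons perm_catC (perm_filterC (fun p : nat * bool => p.1
  < e.1)).
Qed.

Lemma keys_inss_sorted x b S : sorted ltn (keys S) -> x \notin keys S ->
  sorted ltn (keys (inss (x, b) S)).
Proof.
move=> sS xS; rewrite ltn_sorted_uniq_leq; apply/andP; split.
  rewrite (perm_uniq (perm_map fst (perm_inss (x, b) S))) /= xS.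
  by move: sS; rewrite ltn_sorted_uniq_leq => /andP[].
have sS' : sorted leq (keys S) by move: sS; rewrite ltn_sorted_uniq_leq => /andP[].
rewrite /keys /inss map_cat /= (sorted_pairwise leq_trans) pairwise_cat /=.
rewrite -!(sorted_pairwise leq_trans).
have sf (P : pred nat) : sorted leq [seq y <- keys S | P y].
  by apply: sorted_filter => //; apply: leq_trans.
have e1 : [seq i.1 | i <- S & i.1 < x] = [seq y <- keys S | y < x] by rewrite filter_map.
have e2 : [seq i.1 | i <- S & ~~ (i.1 < x)] = [seq y <- keys S | ~~ (y < x)] by rewrite filter_map.
rewrite e1 e2 !sf !andbT; apply/andP; split.
  apply/allrelP => y z; rewrite mem_filter => /andP[yx _]; rewrite inE mem_filter.
  case/orP => [/eqP->|/andP[xz _]]; first exact: ltnW.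
  by rewrite -leqNgt in xz; apply: ltnW (leq_trans yx xz).
by apply/allP => z; rewrite mem_filter -leqNgt => /andP[].
Qed.

Lemma row_keys_inss_eq x b S : row_keys b (inss (x, b) S) = insl x (row_keys b S).
Proof.
rewrite /insl /row_keys /inss filter_cat map_cat /= eqxx /= !filter_map -!filter_predI.
by congr (_ ++ _ :: _); apply: (congr1 (map fst)); apply: eq_filter => p /=; rewrite andbC.
Qed.

Lemma row_keys_inss_neq x b c S : sorted ltn (keys S) -> b != c ->
  row_keys c (inss (x, b) S) = row_keys c S.
Proof.
move=> sS ne; rewrite row_keys_cat /=; have [-> ->] := filter_sorted x sS.
by rewrite {2}/row_keys /= (negbTE ne) -/(row_keys c _) -row_keys_cat cat_take_drop.
Qed.

Lemma count_row_keys x b S : sorted ltn (keys S) ->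
  count (pred1 b) (take (rank x (keys S)) (tags S)) = count (fun y => y < x) (row_keys b S).
Proof.
move=> sS; rewrite -map_take -(filter_sorted x sS).1 count_map count_filter /row_keys count_map
  count_filter.
by apply: eq_count => p /=; rewrite andbC.
Qed.

(** The list [w] is a queue of first-row keys not yet matched, and its size is the current height.
    Each second-row key is matched with the oldest of them, which is smaller. *)
Lemma all2_row_keys w S : bal (size w) (tags S) -> sorted ltn (keys S) ->
  {in w & keys S, forall x y, x < y} -> all2 ltn (w ++ row_keys true S) (row_keys false S).
Proof.
elim: S w => [|[x b] S IH] w /=; first by move=> /nilP-> .
move=> bw sS ws; have xS := allP (order_path_min ltn_trans sS).
case: b bw => /=.
  move=> bw; rewrite /row_keys /= -/(row_keys true S) -/(row_keys false S) -cat_rcons.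
  apply: IH; rewrite ?size_rcons ?(path_sorted sS) //.
  move=> y z; rewrite mem_rcons inE => /orP[/eqP->|yw] zS; first exact: xS.
  by apply: ws; rewrite // inE zS orbT.
case: w ws => //= x0 w ws bw; rewrite /row_keys /= -/(row_keys true S) -/(row_keys false S).
rewrite ws ?inE ?eqxx //=; apply: IH => //; first exact: path_sorted sS.
by move=> y z yw zS; apply: ws; rewrite inE ?yw ?zS ?orbT.
Qed.

Section Steps.
Variable N : nat.
Let lam := [:: N; N].
Implicit Types (T : filling lam) (k : 'I_(sumn lam).+1).

Definition nps_step T0 (c : cell lam) (st : filling lam * nat) : filling lam * nat :=
  let: (T', x) := nps_insert (T0 c) st.1 in (T', st.2 + x).

Lemma split_tags S v1 b v2 : tags S = v1 ++ b :: v2 ->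
  exists P z Q, [/\ S = P ++ (z, b) :: Q, tags P = v1 & tags Q = v2].
Proof.
elim: v1 S => [|c v1 IH] [|[z c'] S] //= [-> e]; first by exists [::], z, S.
by have [P [z' [Q [-> <- <-]]]] := IH _ e; exists ((z, c) :: P), z', Q.
Qed.

Lemma rank_cat x s1 s2 : rank x (s1 ++ s2) = rank x s1 + rank x s2.
Proof. exact: count_cat. Qed.

Lemma rank_all x s : {in s, forall y, y < x} -> rank x s = size s.
Proof. by move=> lt; apply/eqP; rewrite -all_count; apply/allP. Qed.

Lemma rank_none x s : {in s, forall y, x <= y} -> rank x s = 0.
Proof.
move=> le; apply/eqP; rewrite -leqn0 leqNgt -has_count; apply/hasPn => y /le.
by rewrite -leqNgt.
Qed.

(** The bottom entry moves only within the second row, so the encoding just gains one key tagged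
    [false]. *)
Lemma bottom_step k T a b0 S :
  injective T -> has_rows T (a ++ row_keys true S) (b0 ++ (k : nat) :: row_keys false S) ->
  sorted ltn (keys S) ->
  exists2 T', nps_insert k T = (T', count negb (take (rank k (keys S)) (tags S))) &
    injective T' /\ has_rows T' (a ++ row_keys true (inss (k : nat, false) S))
                               (b0 ++ row_keys false (inss (k : nat, false) S)).
Proof.
move=> injT rT sS; rewrite row_keys_inss_eq row_keys_inss_neq //.
have [|T' e [injT' rT']] := loop_row1 (fuel := size lam + head 0 lam) injT rT (sorted_row_keys
  false sS).
  by have [_ sb _] := rT; apply: (@leq_trans N (size _)); [rewrite -[X in _ <= X]sb size_cat /=;
    lia|apply: leq_addl].
exists T' => //; rewrite /nps_insert e -count_row_keys //.
by congr (_, _); apply: eq_count => -[].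
Qed.

Lemma sorted_keys_mid P z b Q : sorted ltn (keys (P ++ (z, b) :: Q)) ->
  [/\ {in keys P, forall y, y < z}, {in keys Q, forall y, z < y}, sorted ltn (keys P) & sorted
    ltn (keys Q)].
Proof.
rewrite /keys map_cat /= !(sorted_pairwise ltn_trans) pairwise_cat allrel_consr /=.
case/and3P=> /andP[/allP Pz _] sP /andP[/allP zQ sQ]; split => //.
Qed.

(** Cut [S] at the first passage below 0, at a key [z]. The part before it has as many keys in each
    row, so [z] is the entry [y] of [loop_row0], which decides whether [k] changes row. *)
Lemma top_step k T a0 b0 S :
  injective T -> has_rows T (a0 ++ (k : nat) :: row_keys true S) (b0 ++ row_keys false S) ->
  size a0 = size b0 -> sorted ltn (keys S) -> bal 1 (tags S) -> (k : nat) \notin keys S ->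
  exists S', exists2 T', nps_insert k T = (T', slide_cost (tags S) (rank k (keys S))) &
    [/\ injective T', has_rows T' (a0 ++ row_keys true S') (b0 ++ row_keys false S'),
      sorted ltn (keys S'), perm_eq (keys S') ((k : nat) :: keys S) & tags S' = slide (tags S)
        (rank k (keys S))].
Proof.
move=> injT rT sab sS bS kS.
have [v1 [v2 [ev b1 b2]]] := bal_first (k := 0) bS.
have [P [z [Q [eS tP tQ]]]] := split_tags ev.
have [Pz zQ sP sQ] : [/\ {in keys P, forall y, y < z}, {in keys Q, forall y, z < y}, sorted ltn
  (keys P) & sorted ltn (keys Q)].
  by apply: (@sorted_keys_mid _ _ false); rewrite -eS.
have tS : row_keys true S = row_keys true P ++ row_keys true Q by rewrite eS row_keys_cat.
have fS : row_keys false S = row_keys false P ++ z :: row_keys false Q by rewrite eS row_keys_cat.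
have sizeP : size (row_keys true P) = size (row_keys false P).
  rewrite !size_row_keys tP (@eq_count _ (pred1 true) id); last by case.
  by rewrite (@eq_count _ (pred1 false) negb) -?(bal_count b1) //; case.
have [||||||T' eT [injT' rT']] := @loop_row0 N k (size lam + head 0 lam) T a0 (row_keys true P)
  (row_keys true Q)
    b0 (row_keys false P) z (row_keys false Q) injT _ sab sizeP.
- by rewrite -tS -fS.
- by have := @all2_row_keys [::] P; rewrite tP; apply.
- by apply/allP => y /mem_row_keys; apply: zQ.
- by rewrite -tS; apply: sorted_row_keys.
- by rewrite -fS; apply: sorted_row_keys.
- have [_ sb _] := rT; apply: (@leq_trans N.+1); last by rewrite -[N.+1]add1n leq_add2r.
  by rewrite ltnS -[X in _ <= X]sb fS !size_cat sizeP /=; lia.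
have rk : rank k (keys S) = rank k (keys P) + ((z < k) + rank k (keys Q)).
  by rewrite eS /keys map_cat /= rank_cat.
have szP : size (keys P) = size v1 by rewrite size_map -(size_map snd) -/(tags P) tP.
have fp : fpos 0 (tags S) = size v1 by rewrite ev fpos_cat.
have leP : rank k (keys P) <= size v1 by rewrite -szP count_size.
case: (ltnP z k) rk eT rT' => [lt|ge] rk eT rT'.
  have rP : rank k (keys P) = size v1.
    by rewrite -szP rank_all // => y /Pz yz; apply: ltn_trans yz lt.
  have gt : (rank k (keys S) <= fpos 0 (tags S)) = false by rewrite fp rk rP; lia.
  (* The entry [k] goes down and [z] takes its place in the first row, which changes the tag of
     [z]. *)
  pose S1 := P ++ (z, true) :: Q.
  have kS1 : keys S1 = keys S by rewrite eS /keys !map_cat.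
  exists (inss (k : nat, false) S1), T'.
    rewrite /nps_insert eT /slide_cost gt (@eq_count _ negb (pred1 false)); last by case.
    rewrite count_row_keys // fS count_cat sizeP /= lt; congr (_, _).
    rewrite (_ : count _ (row_keys false P) = size (row_keys false P)); first lia.
    by apply/eqP; rewrite -all_count; apply/allP => y /mem_row_keys /Pz yz; apply: ltn_trans lt.
  split => //.
  - rewrite row_keys_inss_eq row_keys_inss_neq ?kS1 // /S1 !row_keys_cat.
    rewrite [row_keys true (_ :: _)]/= [row_keys false (_ :: _)]/=.
    rewrite /insl !filter_cat.
    have Pk y : y \in row_keys false P -> y < k by move=> /mem_row_keys /Pz yz; apply: ltn_trans lt.
    rewrite (@eq_in_filter _ _ predT) ?filter_predT; last by move=> y /Pk.
    rewrite (@eq_in_filter _ (fun y => ~~ (y < k)) pred0 (row_keys false P)) ?filter_pred0;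
      last by move=> y /Pk ->.
    by rewrite -catA; exact: rT'.
  - by apply: keys_inss_sorted; rewrite kS1.
  - by rewrite -kS1; exact: (perm_map fst (perm_inss _ _)).
  - rewrite tags_inss kS1 // /slide gt fp ev take_size_cat // drop_size_catS.
    by rewrite /S1 /tags map_cat /= -/(tags P) -/(tags Q) tP tQ.
have rQ : rank k (keys Q) = 0.
  by apply: rank_none => y /zQ zy; apply: leq_trans ge (ltnW zy).
have le : rank k (keys S) <= fpos 0 (tags S) by rewrite fp rk rQ !addn0.
exists (inss (k : nat, true) S), T'.
  rewrite /nps_insert eT /slide_cost le (@eq_count _ id (pred1 true)); last by case.
  by rewrite count_row_keys // tS.
split => //.
- by rewrite row_keys_inss_eq row_keys_inss_neq // tS fS.
- exact: keys_inss_sorted.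
- exact: (perm_map fst (perm_inss _ _)).
- by rewrite tags_inss // /slide le.
Qed.
End Steps.

(** * The complete run, column by column *)

Definition coords lam (c : cell lam) := (cell_row c, cell_col c).
Definition column_coords j m := flatten [seq [:: (0, i); (1, i)] | i <- iota j m].

Lemma coords_inj lam : injective (@coords lam).
Proof. by move=> c d [er ec]; apply: cell_inj. Qed.

Lemma column_coords_uniq j m : uniq (column_coords j m).
Proof.
elim: m j => //= m IH j;
  rewrite /column_coords /= -/(column_coords j.+1 m) !inE negb_or /= IH andbT.
have nin b : (b, j) \notin column_coords j.+1 m.
  apply/flattenP => -[_ /mapP[i + ->]]; rewrite mem_iota => /andP[lt _].
  by rewrite !inE !xpair_eqE => /orP[]/andP[_ /eqP e]; rewrite e ltnn in lt.
by rewrite !nin.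
Qed.

Lemma size_column_coords j m : size (column_coords j m) = m.*2.
Proof. by elim: m j => //= m IH j; rewrite /column_coords /= -/(column_coords j.+1 m) IH. Qed.

Lemma mem_column_coords m p : (p \in column_coords 0 m) = (p.1 < 2) && (p.2 < m).
Proof.
case: p => b i; apply/flattenP/andP => [[_ /mapP[j + ->]]|[/= b2 im]].
  by rewrite mem_iota => /andP[_ lt]; rewrite !inE !xpair_eqE => /orP[]/andP[/eqP-> /eqP->].
exists [:: (0, i); (1, i)]; last by rewrite !inE !xpair_eqE eqxx; case: b b2 => [|[]].
by apply/mapP; exists i; rewrite ?mem_iota.
Qed.

Section TwoRows.
Variable N : nat.
Let lam := [:: N; N].
Implicit Types (T : filling lam) (c : cell lam).

(** In this order the left fold of [nps] becomes a right fold, and the cells already processed form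
    a suffix. *)
Definition cells_increasing := rev (cells_decreasing lam).

Lemma cells_increasing_uniq : uniq cells_increasing.
Proof. by rewrite rev_uniq sort_uniq enum_uniq. Qed.

Lemma mem_cells_increasing c : c \in cells_increasing.
Proof. by rewrite mem_rev mem_sort mem_enum. Qed.

Definition le_coords (p q : nat * nat) := (p.2 < q.2) || ((p.2 == q.2) && (p.1 <= q.1)).

Lemma cells_increasingE : [seq coords c | c <- cells_increasing] = column_coords 0 N.
Proof.
have tr : transitive le_coords.
  by move=> [a b] [c d] [e f]; rewrite /le_coords /=; lia.
apply: (@sorted_eq _ le_coords) => //.
- by move=> [a b] [c d]; rewrite /le_coords /= => h; congr pair; lia.
- rewrite sorted_map /cells_increasing rev_sorted; apply: sort_sorted.
  by move=> c d; rewrite /le_coords /=; lia.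
- rewrite (sorted_pairwise tr); elim: N 0 => // m IH j.
  rewrite /column_coords /= -/(column_coords j.+1 m) IH andbT /le_coords /= ltnn eqxx /=.
  have gt b : all [eta le_coords (b, j)] (column_coords j.+1 m).
    apply/allP => p /flattenP[_ /mapP[i + ->]]; rewrite mem_iota => /andP[lt _].
    by rewrite !inE /le_coords => /orP[]/eqP -> /=; rewrite lt.
  by rewrite !gt.
apply: uniq_perm; rewrite ?column_coords_uniq //.
  by rewrite map_inj_uniq ?cells_increasing_uniq //; apply: coords_inj.
move=> p; rewrite mem_column_coords; apply/mapP/andP => [[c _ ->]|[p1 p2]].
  by split; [apply: cell_rowP|apply: cell_colP].
have [c rc cc] := ex_cell p1 p2; exists c; first exact: mem_cells_increasing.
by rewrite /coords rc cc; case: p {p1 p2 rc cc}.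
Qed.

Definition entries T : seq nat := [seq (T c : nat) | c <- cells_increasing].

Lemma size_cells_increasing : size cells_increasing = N.*2.
Proof.
by rewrite -(size_map (@coords lam)) cells_increasingE size_column_coords.
Qed.

(** Loop invariant once the last [m] columns are processed: the first [j] columns still hold the
    initial entries, and [S] encodes the sorted ones. *)
Lemma nps_states T a b : injective T -> has_rows T a b ->
  forall m j L, m + j = N -> [seq coords c | c <- L] = column_coords j m ->
  exists S, let st := foldr (nps_step T) (T, 0) L in let l := [seq (T c : nat) | c <- L] in
    [/\ injective st.1, has_rows st.1 (take j a ++ row_keys true S) (take j b ++ row_keys false S),
        sorted ltn (keys S), perm_eq (keys S) l & tags S = word l /\ st.2 = cost l].
Proof.
move=> injT rT; have [sa sb Tab] := rT.
elim=> [|m IH] j L /=.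
  rewrite add0n => -> ; case: L => // _; exists [::]; split => //=.
  by rewrite !take_oversize ?sa ?sb // !cats0.
move=> e; have lt : j < N by rewrite -e addSn ltnS leq_addl.
case: L => [|c0 [|c1 L]] // [r0 k0 r1 k1 eL].
have uL : uniq (c0 :: c1 :: L).
  rewrite -(map_inj_uniq (@coords_inj lam)) (_ : map _ _ = column_coords j m.+1)
    ?column_coords_uniq //.
  by rewrite /= /coords r0 k0 r1 k1 -/(coords _) eL.
have [|S] := IH j.+1 L _ eL; first by rewrite addnS -addSn.
rewrite [foldr _ _ (_ :: _)]/=; case: (foldr _ _ L) => T1 n1 /= [inj1 row1 sS pS [tS eS]].
set l := [seq (T c : nat) | c <- L] in pS tS eS *.
(* Distinct cells hold distinct entries, so the entries of the new column are absent from the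
   processed ones. *)
have nS c : c \in [:: c0; c1] -> forall x, x \in l -> x != T c :> nat.
  move=> cc x /mapP[d dL ->]; apply/eqP => /ord_inj /injT ed; rewrite -{c}ed in cc.
  move: uL cc dL; rewrite /= !inE negb_or => /and3P[/andP[_ n0] m1 _] /orP[]/eqP -> h.
    by rewrite h in n0.
  by rewrite h in m1.
have T0 : nth 0 a j = T c0 by rewrite Tab r0 k0.
have T1' : nth 0 b j = T c1 by rewrite Tab r1 k1.
rewrite !(take_nth 0) ?sa ?sb // T0 T1' [rcons (take j b) _ ++ _]cat_rcons in row1.
have [T2 e2 [inj2 row2]] := bottom_step inj1 row1 sS.
rewrite cat_rcons in row2.
set S1 := inss _ S in row2.
have y1 : (T c1 : nat) \notin keys S.
  by rewrite (perm_mem pS); apply/negP => h; have := nS c1 _ _ h;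
    rewrite !inE !eqxx orbT => /(_ isT).
have sS1 : sorted ltn (keys S1) by apply: keys_inss_sorted.
have pS1 : perm_eq (keys S1) ((T c1 : nat) :: l).
  by apply: perm_trans (perm_map fst (perm_inss _ _)) _; rewrite /= perm_cons.
have tS1 : tags S1 = ins (rank (T c1) l) false (word l).
  by rewrite tags_inss // tS (perm_rank _ pS).
have sl : size l = m.*2 by rewrite size_map -(size_map (@coords lam)) eL size_column_coords.
have bS1 : bal 1 (tags S1).
  by rewrite tS1; apply: bal_ins_false; have := word_dyck sl; rewrite mem_dyck => /andP[].
have x1 : (T c0 : nat) \notin keys S1.
  rewrite (perm_mem pS1) inE negb_or; apply/andP; split.
    apply/eqP => /ord_inj /injT e01; move: uL; by rewrite /= e01 mem_head.
  by apply/negP => h; have := nS c0 _ _ h; rewrite !inE !eqxx => /(_ isT).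
have sab : size (take j a) = size (take j b) by rewrite !size_take sa sb.
have [S2 [T3 e3 [inj3 row3 sS2 pS2 tS2]]] := top_step inj2 row2 sab sS1 bS1 x1.
exists S2; rewrite /nps_step /= e2 e3 /=; split => //.
- by apply: perm_trans pS2 _; rewrite perm_cons.
- rewrite tS2 tS1 (perm_rank _ pS1) eS tS (perm_rank _ pS); split => //.
  exact: esym (addnA _ _ _).
Qed.

Lemma nb_exchangesE T : injective T -> nb_exchanges T = cost (entries T).
Proof.
move=> injT.
pose row i := [seq (if [pick c | coords c == (i, j)] is Some c then T c : nat else 0) | j <- iota
  0 N].
have rT : has_rows T (row 0) (row 1).
  split; rewrite ?size_map ?size_iota // => c.
  have lc := cell_colP c.
  have -> : (if cell_row c == 0 then row 0 else row 1) = row (cell_row c).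
    by have := cell_rowP c; case: (cell_row c) => [|[]].
  rewrite (nth_map 0) ?size_iota // nth_iota // add0n.
  by case: pickP => [d /eqP /coords_inj ->|/(_ c)] //; rewrite /coords eqxx.
have [S /= [_ _ _ _ [_ <-]]] := nps_states injT rT (addn0 N) cells_increasingE.
rewrite /nb_exchanges /nps -[cells_decreasing _]revK foldl_rev.
by congr (foldr _ _ _).2.
Qed.

Lemma entries_inj : injective entries.
Proof.
move=> T T' /eq_in_map e; apply/ffunP => c; apply: ord_inj.
by apply: e; apply: mem_cells_increasing.
Qed.

Lemma tableaux_inj T : T \in tableaux lam -> injective T.
Proof. by rewrite inE => /andP[/injectiveP]. Qed.

(** Reading the cells in a fixed order identifies tableaux with permutations of 1, ..., 2N; the
    inverse looks up each cell by its index. *)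
Lemma entries_tableaux : perm_eq [seq entries T | T <- enum (tableaux lam)] (permutations (iota 1
  N.*2)).
Proof.
have sN : sumn lam = N.*2 by rewrite /= addn0 addnn.
apply: uniq_perm; first by rewrite (map_inj_uniq entries_inj) enum_uniq.
  exact: permutations_uniq.
move=> l; rewrite mem_permutations; apply/mapP/idP => [[T]|pl].
  rewrite mem_enum => tT ->; have injT := tableaux_inj tT.
  have ue : uniq (entries T).
    by rewrite map_inj_uniq ?cells_increasing_uniq // => c d /ord_inj /injT.
  have sub : {subset entries T <= iota 1 N.*2}.
    move=> _ /mapP[c _ ->]; move: tT; rewrite inE => /andP[_ /eqP im].
    have : T c \in T @: setT by rewrite imset_f.
    by rewrite im inE mem_iota => -> /=; rewrite add1n -sN ltn_ord.
  have [|_ mem] := uniq_min_size ue sub; first by rewrite size_iota size_map size_cells_increasing.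
  by apply: uniq_perm; rewrite ?iota_uniq.
have sl : size l = N.*2 by rewrite (perm_size pl) size_iota.
have lP c : nth 0 l (index c cells_increasing) \in l.
  by rewrite mem_nth // sl -size_cells_increasing index_mem mem_cells_increasing.
have ul : uniq l by rewrite (perm_uniq pl) iota_uniq.
pose T : filling lam := [ffun c => inord (nth 0 l (index c cells_increasing))].
have TE c : T c = nth 0 l (index c cells_increasing) :> nat.
  rewrite ffunE inordK //; have := lP c; rewrite (perm_mem pl) mem_iota sN => /andP[_].
  by rewrite add1n.
have injT : injective T.
  move=> c d /(congr1 (@nat_of_ord _)); rewrite !TE => /eqP.
  rewrite nth_uniq ?sl -?size_cells_increasing ?index_mem ?mem_cells_increasing // => /eqP e.
  by rewrite -(nth_index c (mem_cells_increasing c)) e nth_index ?mem_cells_increasing.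
have eT : entries T = l.
  apply: (@eq_from_nth _ 0); first by rewrite size_map size_cells_increasing sl.
  move=> i; rewrite size_map => lt.
  have [c _] : exists2 c, c \in cells_increasing & true.
    by case: (cells_increasing) lt => // c s _; exists c; rewrite ?mem_head.
  by rewrite (nth_map c) // TE index_uniq ?cells_increasing_uniq.
exists T; rewrite ?eT // mem_enum inE; apply/andP; split; first exact/injectiveP.
apply/eqP/setP => k; rewrite inE; apply/imsetP/idP => [[c _ ->]|k0].
  by have := lP c; rewrite -TE (perm_mem pl) mem_iota => /andP[].
have kl : (k : nat) \in entries T.
  by rewrite eT (perm_mem pl) mem_iota k0 add1n -sN ltn_ord.
by have /mapP[c _ /ord_inj ->] := kl; exists c.
Qed.

End TwoRows.

Theorem mainTheorem6 (l2 : nat) (hl2 : (0 < l2)%N) :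
  (nps_complexity [:: l2; l2] =
     l2%:R * (l2%:R - 2) / 2
     - 2 * (- (2 ^+ (2 * l2) / 'C(2 * l2, l2)%:R) + harmonic l2 / 2 + 1))%R.
Proof.
rewrite -/(closed_form l2) /nps_complexity.
rewrite (_ : sumn _ = l2.*2); last by rewrite /= addn0 addnn.
apply: (canLR (mulfK _)); first by rewrite Num.Theory.pnatr_eq0 -lt0n fact_gt0.
rewrite mulrC -(sum_cost_closed (iota_uniq 1 _) (size_iota 1 _)).
rewrite -(perm_big _ (entries_tableaux l2)) big_map big_enum /=.
by apply: eq_bigr => T /tableaux_inj injT; rewrite nb_exchangesE.
Qed.
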